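(* Let $g,g^d\in L^2(\mathbb R)$ and $a,b>0$ be such that $G=\{E_{mb}T_{na}g\}_{m,n\in\mathbb Z}$ is a frame for $L^2(\mathbb R)$ and $G^d=\{E_{mb}T_{na}g^d\}_{m,n\in\mathbb Z}$ is a dual frame of $G$. Let $\lambda$ be a positive constant such that $\|I-\lambda S_G\|<1$. Consider the sequence $\{g^p\}_{p=0}^\infty$ determined by $$g^0:=g^d,\qquad g^{p+1}:=\lambda g+(I-\lambda S_G)g^p,\quad p\in\mathbb N_0.$$ Then $\{g^p\}_{p=0}^\infty$ is a sequence of dual windows of $G$ which converges (in $L^2(\mathbb R)$) to the canonical dual window $S_G^{-1}g$. If $g$ and $g^d$ are furthermore compactly supported, then $g^p$, $p\in\mathbb N$, are also compactly supported.
   Context: For $\nu,t\in\mathbb R$, the modulation and translation operators on $L^2(\mathbb R)$ are $(E_\nu f)(x)=e^{2\pi i\nu x}f(x)$ and $(T_tf)(x)=f(x-t)$. A countable family $\{g_k\}_{k\in I}$ in a separable Hilbert space $\mathcal H$ is a frame for $\mathcal H$ if there are constants $A,B>0$ with $A\|h\|^2\le\sum_{k}|\langle h,g_k\rangle|^2\le B\|h\|^2$ for all $h\in\mathcal H$. A dual frame of a frame $\{g_k\}_{k\in I}$ is a frame $\{f_k\}_{k\in I}$ for $\mathcal H$ with $h=\sum_k\langle h,g_k\rangle f_k=\sum_k\langle h,f_k\rangle g_k$ for all $h\in\mathcal H$. A function $\phi\in L^2(\mathbb R)$ is a dual window of a Gabor frame $\{E_{mb}T_{na}g\}_{m,n\in\mathbb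 Z}$ if $\{E_{mb}T_{na}\phi\}_{m,n\in\mathbb Z}$ is a dual frame of it (with the same indexing by $(m,n)$). The frame operator of $G=\{E_{mb}T_{na}g\}_{m,n\in\mathbb Z}$ is $S_Gh=\sum_{m,n\in\mathbb Z}\langle h,E_{mb}T_{na}g\rangle E_{mb}T_{na}g$, a bounded bijective operator on $L^2(\mathbb R)$; $S_G^{-1}g$ is called the canonical dual window of $G$. $I$ is the identity operator on $L^2(\mathbb R)$, $\|I-\lambda S_G\|$ is the operator norm, $\mathbb N=\{1,2,\dots\}$ and $\mathbb N_0=\mathbb N\cup\{0\}$. *)

(* Defs.v *)
(* Elements of L^2(R) are represented by Borel functions R -> R[i] that are
   square integrable for the Lebesgue measure; equality in L^2(R) is equality
   almost everywhere, and every operation below respects it.  The operations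
   that select a vector (frame_op, frame_op_inv) select one representative of
   its class. *)
From HB Require Import structures.
From mathcomp Require Import all_boot all_order all_algebra finmap.
From mathcomp Require Import all_classical all_reals all_analysis.
From mathcomp Require Import complex.
Import Order.TTheory GRing.Theory Num.Theory.
Import numFieldNormedType.Exports.

Set Implicit Arguments.
Unset Strict Implicit.
Unset Printing Implicit Defensive.

Local Open Scope classical_set_scope.
Local Open Scope ring_scope.
Local Open Scope complex_scope.

Section L2.
Context {R : realType}.
Local Notation mu := (@lebesgue_measure R).
Implicit Types (f g h : R -> R[i]).

Definition cmod (z : R[i]) : R := Normc.normc z.

Definition L2norm f : \bar R := Lnorm mu 2%:E (fun x => (cmod (f x))%:E).

Definition L2 : set (R -> R[i]) :=
  [set f | [/\ measurable_fun setT (fun x : R => complex.Re (f x)),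
               measurable_fun setT (fun x : R => complex.Im (f x)) &
               (L2norm f < +oo)%E]].

Definition L2dot f g : R[i] :=
  (\int[mu]_x complex.Re (f x * (g x)^*)) +i*
  (\int[mu]_x complex.Im (f x * (g x)^*)).

Definition L2cvg (u : nat -> R -> R[i]) f :=
  L2norm (fun x => u n x - f x) @[n --> \oo] --> 0%E.

(* Unconditional convergence, in L^2(R), of the series of the u k to s: no
   order on the index set is involved. *)
Definition L2sum (I : choiceType) (u : I -> R -> R[i]) (s : R -> R[i]) :=
  forall eps : R, 0 < eps ->
  exists F0 : {fset I}, forall F : {fset I}, (F0 `<=` F)%fset ->
    (L2norm (fun x => (s x - \sum_(k <- F) u k x)%R) < eps%:E)%E.

Definition opnorm (T : (R -> R[i]) -> (R -> R[i])) : \bar R :=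
  ereal_sup [set L2norm (T h) | h in L2 `&` [set h | (L2norm h <= 1)%E]].

(* A function class has compact support when one of its representatives
   vanishes outside of a compact set. *)
Definition compactly_supported f :=
  exists2 K : set R, compact K & {ae mu, forall x, ~ K x -> f x = 0}.

Section frames.
Context {I : countType}.
Implicit Types (u v : I -> R -> R[i]).

Definition is_frame u :=
  (forall k, L2 (u k)) /\
  exists A B : R, [/\ 0 < A, 0 < B & forall h, L2 h ->
    (A%:E * L2norm h ^+ 2 <= \esum_(k in setT) (cmod (L2dot h (u k)) ^+ 2)%R%:E
       <= B%:E * L2norm h ^+ 2)%E].

Definition is_dual_frame u v :=
  is_frame v /\
  forall h, L2 h -> L2sum (fun k x => L2dot h (u k) * v k x) h /\
                    L2sum (fun k x => L2dot h (v k) * u k x) h.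

Definition frame_op u h : R -> R[i] :=
  xget (cst 0 : {classic R -> R[i]})
    [set s | L2 s /\ L2sum (fun k x => L2dot h (u k) * u k x) s].

Definition frame_op_inv u h : R -> R[i] :=
  xget (cst 0 : {classic R -> R[i]})
    [set s | L2 s /\ frame_op u s = h %[ae mu]].

End frames.

Definition modulation (nu : R) f : R -> R[i] :=
  fun x => (cos (2 * pi * nu * x) +i* sin (2 * pi * nu * x)) * f x.

Definition translation (t : R) f : R -> R[i] := fun x => f (x - t).

Definition gabor g (a b : R) (k : int * int) : R -> R[i] :=
  modulation (k.1%:~R * b) (translation (k.2%:~R * a) g).

Definition dual_window g (a b : R) (phi : R -> R[i]) :=
  L2 phi /\ is_dual_frame (gabor g a b) (gabor phi a b).

Definition canonical_dual_window g (a b : R) : R -> R[i] :=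
  frame_op_inv (gabor g a b) g.

Definition id_sub_scaled (lambda : R) (T : (R -> R[i]) -> (R -> R[i])) h :
  R -> R[i] := fun x => h x - lambda%:C * T h x.

Fixpoint window_seq g gd (a b lambda : R) (p : nat) : R -> R[i] :=
  if p is q.+1 then
    fun x => lambda%:C * g x +
      id_sub_scaled lambda (frame_op (gabor g a b))
        (window_seq g gd a b lambda q) x
  else gd.

End L2.

(* Main.v *)
From HB Require Import structures.
Require Import Defs.
From mathcomp Require Import all_boot all_order all_algebra finmap.
From mathcomp Require Import all_classical all_reals all_analysis.
From mathcomp Require Import measurable_realfun complex ring lra.
Import Order.TTheory GRing.Theory Num.Theory.
Import numFieldNormedType.Exports.
Set Implicit Arguments.
Unset Strict Implicit.
Unset Printing Implicit Defensive.
Local Open Scope classical_set_scope.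
Local Open Scope ring_scope.
Local Open Scope complex_scope.

Local Notation Re := complex.Re.
Local Notation Im := complex.Im.

(** Write S for the frame operator of G and T = I - lambda S.  The recursion
    g^(p+1) = lambda g + T g^p is the Richardson iteration for the equation
    S y = g, whose solution is the canonical dual window.

    Duality is preserved by each step because S commutes with every
    time-frequency shift [frame_operator_commute], so that shifting g^(p+1)
    gives lambda g_k + T f_k, where g_k and f_k are the shifts of g and of g^p.
    If g^p is a dual window, then
      sum <h, g_k> (lambda g_k + T f_k) = lambda S h + T h = h, and
      sum <h, lambda g_k + T f_k> g_k = lambda S h + T h = h,
    the second by self-adjointness of S [dual_step_reconstructs,
    dual_step_reconstructs_swap].  The upper frame bound passes through the step
    by the triangle inequality, and the lower frame bound is a consequence of the
    expansion of h in the Bessel family G [reconstructs_lower].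

    Convergence holds because T contracts distances by a factor c < 1: a
    fixpoint exists [contraction_fixpoint], the fixpoints are exactly the
    solutions of S y = g [relax_step_fixpoint], and the distance from g^p to any
    of them is at most a multiple of c ^ p.

    For compact supports, g and g^p vanish outside of some [-M, M]; every term
    <g^p, g_k> g_k of the series of S g^p then vanishes outside of [-3 M, 3 M],
    since the coefficient is zero as soon as the translation exceeds 2 M
    [gabor_term_supported], and the set of vectors vanishing there is closed
    [supported_hsum].

    All of this takes place in a complete space with a positive semidefinite
    inner product, so that square integrable functions need not be replaced by
    their classes.  That they form such a space is the Riesz-Fischer theorem
    [mean_square_complete]; completeness is what makes the series of S h
    [bessel_summable] and the iteration converge. *)

(** * Moduli of complex numbers *)

Section cmod.
Context {R : realType}.
Implicit Types z w : R[i].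

Lemma Re_add z w : Re (z + w) = Re z + Re w.
Proof. by case: z; case: w. Qed.

Lemma Im_add z w : Im (z + w) = Im z + Im w.
Proof. by case: z; case: w. Qed.

Lemma Re_opp z : Re (- z) = - Re z.
Proof. by case: z. Qed.

Lemma Im_opp z : Im (- z) = - Im z.
Proof. by case: z. Qed.

Lemma Re_mul z w : Re (z * w) = Re z * Re w - Im z * Im w.
Proof. by case: z; case: w. Qed.

Lemma Im_mul z w : Im (z * w) = Re z * Im w + Im z * Re w.
Proof. by case: z; case: w. Qed.

Lemma Re_conjc z : Re (conjc z) = Re z.
Proof. by case: z. Qed.

Lemma Im_conjc z : Im (conjc z) = - Im z.
Proof. by case: z. Qed.

Lemma Re_sum (I : Type) (s : seq I) (F : I -> R[i]) :
  Re (\sum_(i <- s) F i) = \sum_(i <- s) Re (F i).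
Proof. by elim/big_rec2: _ => // i x y _ <-; rewrite Re_add. Qed.

Lemma cmod_ge0 z : 0 <= cmod z.
Proof. by case: z => x y; rewrite sqrtr_ge0. Qed.

Lemma sqr_cmod z : cmod z ^+ 2 = Re z ^+ 2 + Im z ^+ 2.
Proof. by case: z => x y; rewrite sqr_sqrtr // addr_ge0 // sqr_ge0. Qed.

Lemma cmodM z w : cmod (z * w) = cmod z * cmod w.
Proof. exact: Normc.normcM. Qed.

Lemma cmodD z w : cmod (z + w) <= cmod z + cmod w.
Proof. exact: le_normcD. Qed.

Lemma cmod_eq0 z : cmod z = 0 -> z = 0.
Proof. exact: Normc.eq0_normc. Qed.

Lemma cmod0 : cmod (0 : R[i]) = 0.
Proof. exact: Normc.normc0. Qed.

Lemma cmodN z : cmod (- z) = cmod z.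
Proof. exact: normcN. Qed.

Lemma cmodJ z : cmod (conjc z) = cmod z.
Proof. by case: z => x y /=; rewrite sqrrN. Qed.

Lemma cmodR (x : R) : cmod x%:C = `|x|.
Proof. by rewrite /cmod /= expr0n addr0 sqrtr_sqr. Qed.

Lemma mul_conjc z : z * conjc z = (cmod z ^+ 2)%:C.
Proof.
apply/eqP; rewrite eq_complex sqr_cmod Re_mul Im_mul Re_conjc Im_conjc /=.
by apply/andP; split; apply/eqP; ring.
Qed.

Lemma Re_le_cmod z : Re z <= cmod z.
Proof.
case: z => x y /=; apply: le_trans (ler_norm _) _.
by rewrite -sqrtr_sqr ler_wsqrtr // lerDl sqr_ge0.
Qed.

End cmod.

(** * Complete spaces with a semi-inner product *)

(** The form is semidefinite, so that square integrable functions are vectors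
    themselves and equality in L^2 is distance zero.  Completeness is stated with
    squared norms, the norm being defined from the inner product only
    afterwards. *)
Record semiHilbert (R : realType) := SemiHilbert {
  hsort :> lmodType R[i];
  hdot : hsort -> hsort -> R[i];
  hdotDl : forall x y z, hdot (x + y) z = hdot x z + hdot y z;
  hdotZl : forall c x z, hdot (c *: x) z = c * hdot x z;
  hdotC : forall x y, hdot y x = conjc (hdot x y);
  hdot_ge0 : forall x, 0 <= Re (hdot x x);
  hcomplete : forall v : nat -> hsort,
    (forall eps, 0 < eps -> exists N, forall m n, (N <= m)%N -> (N <= n)%N ->
       Re (hdot (v m - v n) (v m - v n)) < eps) ->
    exists l, forall eps, 0 < eps -> exists N, forall n, (N <= n)%N ->
       Re (hdot (v n - l) (v n - l)) < eps }.

Definition hnorm (R : realType) (H : semiHilbert R) (x : H) : R :=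
  Num.sqrt (Re (hdot x x)).

Section norm.
Context {R : realType} {H : semiHilbert R}.
Implicit Types (x y z : H) (c : R[i]).

Lemma hdotDr x y z : hdot z (x + y) = hdot z x + hdot z y.
Proof. by rewrite hdotC hdotDl rmorphD /= -!hdotC. Qed.

Lemma hdotZr c x z : hdot z (c *: x) = conjc c * hdot z x.
Proof. by rewrite hdotC hdotZl rmorphM /= -hdotC. Qed.

Lemma hdotNl x z : hdot (- x) z = - hdot x z.
Proof. by rewrite -scaleN1r hdotZl mulN1r. Qed.

Lemma hdotNr x z : hdot z (- x) = - hdot z x.
Proof. by rewrite hdotC hdotNl rmorphN /= -hdotC. Qed.

Lemma hdot0l z : hdot 0 z = 0.
Proof. by rewrite -(scale0r (0 : H)) hdotZl mul0r. Qed.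

Lemma hdotBl x y z : hdot (x - y) z = hdot x z - hdot y z.
Proof. by rewrite hdotDl hdotNl. Qed.

Lemma hdotBr x y z : hdot z (x - y) = hdot z x - hdot z y.
Proof. by rewrite hdotDr hdotNr. Qed.

Lemma hdot_suml (I : Type) (s : seq I) (F : I -> H) z :
  hdot (\sum_(i <- s) F i) z = \sum_(i <- s) hdot (F i) z.
Proof. by elim/big_rec2: _ => [|i x y _ <-]; rewrite ?hdot0l // hdotDl. Qed.

Lemma hnorm_ge0 x : 0 <= hnorm x.
Proof. exact: sqrtr_ge0. Qed.

Lemma sqr_hnorm x : hnorm x ^+ 2 = Re (hdot x x).
Proof. by rewrite sqr_sqrtr // hdot_ge0. Qed.

Lemma sqr_hnormB x y :
  hnorm (x - y) ^+ 2 = hnorm x ^+ 2 - 2 * Re (hdot x y) + hnorm y ^+ 2.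
Proof.
rewrite !sqr_hnorm hdotBl !hdotBr (hdotC x y) !(Re_add, Re_opp) Re_conjc; ring.
Qed.

Lemma hnormZ c x : hnorm (c *: x) = cmod c * hnorm x.
Proof.
apply/eqP; rewrite -(@eqrXn2 _ 2) ?mulr_ge0 ?cmod_ge0 ?hnorm_ge0 //.
rewrite exprMn !sqr_hnorm sqr_cmod hdotZl hdotZr !Re_mul Im_mul Re_conjc Im_conjc.
have -> : Im (hdot x x) = 0.
  have := congr1 (@Im R) (hdotC x x); rewrite Im_conjc => h.
  by lra.
by apply/eqP; ring.
Qed.

Lemma hnormN x : hnorm (- x) = hnorm x.
Proof. by rewrite -scaleN1r hnormZ cmodN [cmod 1]Normc.normc1 mul1r. Qed.

Lemma hnorm0 : hnorm (0 : H) = 0.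
Proof. by rewrite -(scale0r (0 : H)) hnormZ cmod0 mul0r. Qed.

Lemma hnormC x y : hnorm (x - y) = hnorm (y - x).
Proof. by rewrite -hnormN opprB. Qed.

(** The quadratic t |-> |x - t <x, y> y|^2 is nonnegative, whence the bound when
    y is nonzero; when y has norm zero it is affine in t, which forces
    <x, y> = 0. *)
Lemma cauchy_schwarz x y : cmod (hdot x y) <= hnorm x * hnorm y.
Proof.
set m := cmod _; have m0 : 0 <= m by exact: cmod_ge0.
have key t : 0 <= hnorm x ^+ 2 - 2 * t * m ^+ 2 + (t * m * hnorm y) ^+ 2.
  have := sqr_ge0 (hnorm (x - (t%:C * hdot x y) *: y)).
  rewrite sqr_hnormB hnormZ hdotZr cmodM cmodR -/m !exprMn -normrX.
  rewrite (ger0_norm (sqr_ge0 t)) sqr_cmod !(Re_mul, Im_mul, Re_conjc, Im_conjc) /=.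
  by congr (0 <= _); ring.
have [y0|yn0] := eqVneq (hnorm y) 0.
  rewrite y0 mulr0 leNgt; apply/negP => m_gt0.
  have := key ((hnorm x ^+ 2 + 1) / (2 * m ^+ 2)); rewrite y0 mulr0 expr0n addr0.
  have -> : 2 * ((hnorm x ^+ 2 + 1) / (2 * m ^+ 2)) * m ^+ 2 = hnorm x ^+ 2 + 1.
    by field; rewrite gt_eqF.
  by lra.
have y_gt0 : 0 < hnorm y by rewrite lt_neqAle eq_sym yn0 hnorm_ge0.
rewrite -(@ler_pXn2r _ 2) // ?nnegrE ?mulr_ge0 ?hnorm_ge0 //.
have := key (hnorm y ^+ 2)^-1.
have -> : hnorm x ^+ 2 - 2 * (hnorm y ^+ 2)^-1 * m ^+ 2 +
   ((hnorm y ^+ 2)^-1 * m * hnorm y) ^+ 2 = hnorm x ^+ 2 - m ^+ 2 / hnorm y ^+ 2.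
  by field.
by rewrite subr_ge0 ler_pdivrMr ?exprn_gt0 // exprMn.
Qed.

Lemma hnormD x y : hnorm (x + y) <= hnorm x + hnorm y.
Proof.
rewrite -(@ler_pXn2r _ 2) // ?nnegrE ?addr_ge0 ?hnorm_ge0 //.
rewrite -{1}[y]opprK sqr_hnormB hnormN hdotNr Re_opp.
have := le_trans (Re_le_cmod _) (cauchy_schwarz x y).
rewrite sqrrD; lra.
Qed.

Lemma hnormB_trans x y z : hnorm (x - z) <= hnorm (x - y) + hnorm (y - z).
Proof. by have := hnormD (x - y) (y - z); rewrite addrA subrK. Qed.

(** Two vectors at distance zero represent the same point of the Hilbert
    space. *)
Definition heq x y := hnorm (x - y) = 0.

Lemma hnorm_le0 x : hnorm x <= 0 -> hnorm x = 0.
Proof. by move=> h; apply/eqP; rewrite eq_le h hnorm_ge0. Qed.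

Lemma heq_refl x : heq x x.
Proof. by rewrite /heq subrr hnorm0. Qed.

Lemma heq_sym x y : heq x y -> heq y x.
Proof. by rewrite /heq hnormC. Qed.

Lemma heq_trans y x z : heq x y -> heq y z -> heq x z.
Proof.
move=> xy yz; apply: hnorm_le0; apply: le_trans (hnormB_trans _ y _) _.
by rewrite xy yz addr0.
Qed.

Lemma heqD x y x' y' : heq x x' -> heq y y' -> heq (x + y) (x' + y').
Proof.
move=> xx yy; apply: hnorm_le0; rewrite opprD addrACA.
by apply: le_trans (hnormD _ _) _; rewrite xx yy addr0.
Qed.

Lemma heqZ c x x' : heq x x' -> heq (c *: x) (c *: x').
Proof. by move=> xx; rewrite /heq -scalerBr hnormZ xx mulr0. Qed.

Lemma heqB x y x' y' : heq x x' -> heq y y' -> heq (x - y) (x' - y').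
Proof. by move=> xx /(heqZ (-1)); rewrite !scaleN1r; exact: heqD. Qed.

Lemma heq_sum (I : Type) (s : seq I) (F G : I -> H) :
  (forall i, heq (F i) (G i)) -> heq (\sum_(i <- s) F i) (\sum_(i <- s) G i).
Proof.
by move=> FG; elim/big_rec2: _ => [|i x y _]; [exact: heq_refl|exact: heqD].
Qed.

Lemma heq_hdotl x y z : heq x y -> hdot x z = hdot y z.
Proof.
move=> xy; apply/eqP; rewrite -subr_eq0 -hdotBl; apply/eqP/cmod_eq0/eqP.
by rewrite eq_le cmod_ge0 andbT (le_trans (cauchy_schwarz _ _)) // xy mul0r.
Qed.

Lemma heq_hdotr x y z : heq x y -> hdot z x = hdot z y.
Proof. by move=> xy; rewrite hdotC (heq_hdotl _ xy) -hdotC. Qed.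

End norm.

(** * Unconditional sums *)

Section unconditional_sums.
Context {R : realType} {I : choiceType}.
Implicit Types (H : semiHilbert R).

Definition hsum H (u : I -> H) (s : H) :=
  forall eps : R, 0 < eps -> exists F0 : {fset I}, forall F : {fset I},
    (F0 `<=` F)%fset -> hnorm (s - \sum_(k <- F) u k) < eps.

Lemma hsum_unique H (u : I -> H) s t : hsum u s -> hsum u t -> heq s t.
Proof.
move=> us ut; apply: hnorm_le0; apply/ler_addgt0Pl => e e0; rewrite addr0.
have [F1 h1] := us (e / 2) ltac:(lra); have [F2 h2] := ut (e / 2) ltac:(lra).
have {}h1 := h1 (F1 `|` F2)%fset (fsubsetUl _ _).
have {}h2 := h2 (F1 `|` F2)%fset (fsubsetUr _ _).
rewrite hnormC in h2.
by have := hnormB_trans s (\sum_(k <- (F1 `|` F2)%fset) u k) t; lra.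
Qed.

Lemma hsum_heq H (u v : I -> H) s t :
  (forall k, heq (u k) (v k)) -> heq s t -> hsum u s -> hsum v t.
Proof.
move=> uv st us e e0; have [F0 h0] := us e e0; exists F0 => F /h0 h.
have := hnormB_trans t s (\sum_(k <- F) v k).
have := hnormB_trans s (\sum_(k <- F) u k) (\sum_(k <- F) v k).
have /= := heq_sum F uv; rewrite /heq => ->.
have := heq_sym st; rewrite /heq => ->; lra.
Qed.

Lemma hsumD H (u v : I -> H) s t :
  hsum u s -> hsum v t -> hsum (fun k => u k + v k) (s + t).
Proof.
move=> us vt e e0.
have [F1 h1] := us (e / 2) ltac:(lra); have [F2 h2] := vt (e / 2) ltac:(lra).
exists (F1 `|` F2)%fset => F sF.
have {}h1 := h1 F (fsubset_trans (fsubsetUl _ _) sF).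
have {}h2 := h2 F (fsubset_trans (fsubsetUr _ _) sF).
rewrite big_split opprD addrACA; have := hnormD (s - \sum_(k <- F) u k)
  (t - \sum_(k <- F) v k) ; lra.
Qed.

(** The map T is only required to be additive up to distance zero, as is the
    case for an operator defined by choosing a representative of its value. *)
Lemma hsum_map H H' (T : H -> H') (M : R) (u : I -> H) s :
  (forall x y, heq (T (x + y)) (T x + T y)) ->
  (forall x y, hnorm (T x - T y) <= M * hnorm (x - y)) ->
  hsum u s -> hsum (fun k => T (u k)) (T s).
Proof.
move=> TD TM us e e0.
have T0 : heq (T 0) 0.
  by have := TD 0 0; rewrite /heq addr0 opprD addNKr hnormN subr0.
have Tsum (F : seq I) : heq (T (\sum_(k <- F) u k)) (\sum_(k <- F) T (u k)).
  elim/big_rec2: _ => // k x y _ h; apply: heq_trans (TD _ _) _.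
  exact: heqD (heq_refl _) h.
have N_gt0 : 0 < Num.max M 1 by rewrite lt_max ltr01 orbT.
have [F0 h0] := us (e / Num.max M 1) (divr_gt0 e0 N_gt0).
exists F0 => F /h0; rewrite ltr_pdivlMr // => h.
apply: le_lt_trans h; apply: le_trans (hnormB_trans _ (T (\sum_(k <- F) u k)) _) _.
rewrite Tsum addr0 mulrC; apply: le_trans (TM _ _) _.
by rewrite ler_wpM2r ?hnorm_ge0 // le_max lexx.
Qed.

Lemma hsumZ H (c : R[i]) (u : I -> H) s :
  hsum u s -> hsum (fun k => c *: u k) (c *: s).
Proof.
apply: (@hsum_map _ _ (fun x => c *: x) (cmod c)) => [x y|x y].
  by rewrite scalerDr; exact: heq_refl.
by rewrite -scalerBr hnormZ.
Qed.

Lemma hsum_hdot H (u : I -> H) s (h : H) (eps : R) : hsum u s -> 0 < eps ->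
  exists F0 : {fset I}, forall F : {fset I}, (F0 `<=` F)%fset ->
    cmod (hdot s h - \sum_(k <- F) hdot (u k) h) < eps.
Proof.
move=> us e0; have N_gt0 : 0 < hnorm h + 1 by rewrite ltr_wpDl ?hnorm_ge0.
have [F0 h0] := us (eps / (hnorm h + 1)) (divr_gt0 e0 N_gt0).
exists F0 => F /h0; rewrite ltr_pdivlMr // -hdot_suml -hdotBl => lt_eps.
apply: le_lt_trans (cauchy_schwarz _ _) (le_lt_trans _ lt_eps).
by rewrite ler_wpM2l ?hnorm_ge0 // lerDl.
Qed.

Lemma hsum_reindex H (f g : I -> I) (u : I -> H) s :
  cancel f g -> cancel g f -> hsum u s -> hsum (u \o f) s.
Proof.
move=> fK gK us e e0; have [F0 h0] := us e e0.
exists [fset g k | k in F0]%fset => F sF.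
have := h0 [fset f k | k in F]%fset.
rewrite big_imfset /=; last by move=> x y _ _; exact: (can_inj fK).
apply; apply/fsubsetP => k kF0; apply/imfsetP; exists (g k); rewrite ?gK //.
by apply: (fsubsetP sF); apply/imfsetP; exists k.
Qed.

End unconditional_sums.

(** * Bessel families *)

Section bessel.
Context {R : realType} {H : semiHilbert R} {I : choiceType}.
Implicit Types (u v : I -> H) (h : H) (F : {fset I}).

Definition bessel u (B : R) : Prop := forall h F,
  \sum_(k <- F) cmod (hdot h (u k)) ^+ 2 <= B * hnorm h ^+ 2.

Lemma mulr_le_mean (B x y : R) : 0 < B ->
  x * y <= 2^-1 * (B * x ^+ 2 + B^-1 * y ^+ 2).
Proof.
move=> B0; rewrite -subr_ge0.
have -> : 2^-1 * (B * x ^+ 2 + B^-1 * y ^+ 2) - x * y =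
    2^-1 * B^-1 * (B * x - y) ^+ 2 by field; rewrite gt_eqF.
by rewrite mulr_ge0 ?sqr_ge0 // mulr_ge0 // invr_ge0 ltW.
Qed.

(** Duality: the pairing of the combination x with itself is a sum of products
    c_k <u_k, x>, and the arithmetic-geometric mean inequality leaves half of
    the square norm of x to be absorbed by the Bessel bound. *)
Lemma bessel_synthesis u B (c : I -> R[i]) F : 0 < B -> bessel u B ->
  hnorm (\sum_(k <- F) c k *: u k) ^+ 2 <= B * \sum_(k <- F) cmod (c k) ^+ 2.
Proof.
move=> B0 uB; set x := \sum_(k <- F) _; have := uB x F.
rewrite mulrC -ler_pdivrMr // mulrC => hB.
suff : hnorm x ^+ 2 <= 2^-1 * (B * (\sum_(k <- F) cmod (c k) ^+ 2) +
   B^-1 * (\sum_(k <- F) cmod (hdot x (u k)) ^+ 2)) by lra.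
rewrite {1}sqr_hnorm {1}/x hdot_suml Re_sum !mulr_sumr -big_split mulr_sumr /=.
apply: ler_sum => k _; rewrite hdotZl; apply: le_trans (Re_le_cmod _) _.
by rewrite cmodM (hdotC x) cmodJ; exact: mulr_le_mean.
Qed.

(** The square sums of the coefficients <h, u_k> over finite sets have a
    supremum; past a finite set that nearly reaches it, what remains of the
    coefficients is small, hence so is what remains of the series. *)
Lemma bessel_summable u B h : 0 < B -> bessel u B ->
  exists s, hsum (fun k => hdot h (u k) *: u k) s.
Proof.
move=> B0 uB; pose part F := \sum_(k <- F) hdot h (u k) *: u k.
pose E := [set \sum_(k <- F) cmod (hdot h (u k)) ^+ 2 | F in [set: {fset I}]]%classic.
have supE : has_sup E.
  split; first by exists (\sum_(k <- fset0) cmod (hdot h (u k)) ^+ 2); exists fset0.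
  by exists (B * hnorm h ^+ 2) => _ [F _ <-]; exact: uB.
have cauchy (e : R) : 0 < e -> exists F0, forall F, (F0 `<=` F)%fset ->
    hnorm (part F - part F0) < e.
  move=> e0; have d0 : 0 < e ^+ 2 / B by rewrite divr_gt0 ?exprn_gt0.
  have [_ [F0 _ <-]] := sup_adherent d0 supE; rewrite ltrBlDr => adh.
  exists F0 => F sF.
  have split_sum (V : zmodType) (f : I -> V) :
      \sum_(k <- F) f k - \sum_(k <- F0) f k = \sum_(k <- (F `\` F0)%fset) f k.
    rewrite (big_fsetID _ (mem F0)) /=.
    have -> : [fset i in F | i \in F0]%fset = F0.
      by apply/fsetP => k; rewrite !inE andb_idl //; exact: (fsubsetP sF).
    by rewrite addrAC subrr add0r; apply: eq_fbigl => k; rewrite !inE andbC.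
  rewrite -(@ltr_pXn2r _ 2) // ?nnegrE ?hnorm_ge0 ?ltW // split_sum.
  apply: le_lt_trans (bessel_synthesis _ _ B0 uB) _.
  rewrite -ltr_pdivlMl // [ltRHS]mulrC -split_sum ltrBlDl.
  apply: le_lt_trans adh; apply: ub_le_sup; first exact: supE.2.
  by exists F.
have [G hG] := choice (fun n : nat => cauchy _ (divr_gt0 ltr01 (ltr0Sn R n))).
have small (e : R) : 0 < e -> exists N, forall n, (N <= n)%N -> 1 / n.+1%:R < e.
  move=> e0; exists (Num.truncn e^-1) => n Nn.
  rewrite ltr_pdivrMr ?ltr0Sn // mulrC -ltr_pdivrMr // div1r.
  by apply: lt_le_trans (truncnS_gt _) _; rewrite ler_nat ltnS.
have dist n F : (G n `<=` F)%fset -> hnorm (part F - part (G n)) < 1 / n.+1%:R.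
  exact: hG.
have [|s hs] := @hcomplete _ H (part \o G).
  move=> e e0; have se0 : 0 < Num.sqrt e / 2 by rewrite divr_gt0 ?sqrtr_gt0.
  have [N hN] := small _ se0; exists N => m n Nm Nn /=.
  rewrite -sqr_hnorm -[ltRHS]sqr_sqrtr ?ltW //.
  rewrite ltr_pXn2r // ?nnegrE ?hnorm_ge0 ?sqrtr_ge0 //.
  have dm := lt_trans (dist m _ (fsubsetUl (G m) (G n))) (hN m Nm).
  have dn := lt_trans (dist n _ (fsubsetUr (G m) (G n))) (hN n Nn).
  rewrite hnormC in dm.
  by have := hnormB_trans (part (G m)) (part (G m `|` G n)%fset) (part (G n)); lra.
exists s => e e0; have [N1 hN1] := hs ((e / 2) ^+ 2) ltac:(rewrite exprn_gt0 //; lra).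
have [N2 hN2] := small (e / 2) ltac:(lra); pose n := maxn N1 N2.
exists (G n) => F sF; have := hnormB_trans s (part (G n)) (part F).
have := hN1 n (leq_maxl _ _); rewrite -sqr_hnorm /=.
rewrite ltr_pXn2r // ?nnegrE ?hnorm_ge0 //; last by lra.
rewrite (hnormC (part (G n)) s) (hnormC (part (G n)) (part F)).
have := lt_trans (dist n F sF) (hN2 n (leq_maxr _ _)).
by rewrite -/(part F); lra.
Qed.

End bessel.

(** * Contractions *)

Section contraction.
Context {R : realType} {H : semiHilbert R}.
Implicit Types (x y : H) (f : H -> H).

Lemma contraction_iter f (c : R) x y n : 0 <= c ->
  (forall x y, hnorm (f x - f y) <= c * hnorm (x - y)) ->
  hnorm (iter n f x - iter n f y) <= c ^+ n * hnorm (x - y).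
Proof.
move=> c0 fc; elim: n => [|n IH] /=; first by rewrite mul1r.
by apply: le_trans (fc _ _) _; rewrite exprS -mulrA ler_wpM2l.
Qed.

Lemma contraction_iter_fixpoint f (c : R) x y n : 0 <= c ->
  (forall x y, hnorm (f x - f y) <= c * hnorm (x - y)) -> heq (f y) y ->
  hnorm (iter n f x - y) <= c ^+ n * hnorm (x - y).
Proof.
move=> c0 fc fy; elim: n => [|n IH] /=; first by rewrite mul1r.
apply: le_trans (hnormB_trans _ (f y) _) _; rewrite fy addr0.
by apply: le_trans (fc _ _) _; rewrite exprS -mulrA ler_wpM2l.
Qed.

Lemma geometric_small (c M eps : R) : 0 <= c < 1 -> 0 < eps ->
  exists N, forall n, (N <= n)%N -> c ^+ n * M < eps.
Proof.
move=> /andP[c0 c1] e0.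
have : (c ^+ n * M @[n --> \oo] --> (0 : R))%classic.
  rewrite -(mul0r M); apply: cvgMr_tmp; apply: cvg_expr.
  by rewrite ger0_norm.
by move/cvgr_lt => /(_ eps)/(_ e0) [N _ hN]; exists N => n /hN.
Qed.

(** The iterates stay within a fixed distance of the starting point, so that the
    iterates of order at least n are within a multiple of c ^ n of each other;
    their limit is fixed. *)
Lemma contraction_fixpoint f (c : R) : 0 <= c < 1 ->
  (forall x y, hnorm (f x - f y) <= c * hnorm (x - y)) ->
  exists x, heq (f x) x.
Proof.
move=> /andP[c0 c1] fc; pose w n := iter n f 0.
pose M := hnorm (w 1%N - w 0%N) / (1 - c).
have c1' : 0 < 1 - c by rewrite subr_gt0.
have wM n : hnorm (w n - w 0%N) <= M.
  elim: n => [|n IH]; first by rewrite subrr hnorm0 divr_ge0 ?hnorm_ge0 // ltW.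
  have := hnormB_trans (w n.+1) (w 1%N) (w 0%N); have := fc (w n) (w 0%N).
  have -> : hnorm (w 1%N - w 0%N) = M * (1 - c) by rewrite divfK // gt_eqF.
  by have := ler_wpM2l c0 IH; rewrite -[f (w n)]/(w n.+1) -[f _]/(w 1%N); lra.
have wB n m : (n <= m)%N -> hnorm (w m - w n) <= c ^+ n * M.
  move=> nm; rewrite /w -(subnK nm) addnC iterD.
  apply: le_trans (contraction_iter _ _ n c0 fc) _.
  by rewrite ler_wpM2l ?exprn_ge0 //; exact: wM.
have [|x hx] := @hcomplete _ H w.
  move=> e e0; have se0 : 0 < Num.sqrt e by rewrite sqrtr_gt0.
  have [|N hN] := @geometric_small c M (Num.sqrt e) _ se0; first by rewrite c0.
  exists N => m n Nm Nn; rewrite -sqr_hnorm -[ltRHS]sqr_sqrtr ?ltW //.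
  rewrite ltr_pXn2r // ?nnegrE ?hnorm_ge0 ?sqrtr_ge0 //.
  have [mn|/ltnW nm] := leqP m n; last exact: le_lt_trans (wB _ _ nm) (hN _ Nn).
  by rewrite hnormC; exact: le_lt_trans (wB _ _ mn) (hN _ Nm).
exists x; apply: hnorm_le0; apply/ler_addgt0Pl => e e0; rewrite addr0.
have [|N hN] := hx ((e / 2) ^+ 2); first by rewrite exprn_gt0 ?divr_gt0.
have small n : (N <= n)%N -> hnorm (w n - x) < e / 2.
  move=> /hN; rewrite -sqr_hnorm ltr_pXn2r // ?nnegrE ?hnorm_ge0 //.
  by rewrite divr_ge0 ?ltW.
have := hnormB_trans (f x) (f (w N)) x; have := fc x (w N).
have := small N (leqnn _); have := small N.+1 (leqnSn _); rewrite -[w N.+1]/(f (w N)).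
have := ler_wpM2r (hnorm_ge0 (x - w N)) (ltW c1).
rewrite (hnormC (w N) x); lra.
Qed.

End contraction.

(** * Frame operators and the relaxation step *)

Section frame_operator.
Context {R : realType} {H : semiHilbert R} {I : choiceType}.
Context (u : I -> H) (S : H -> H).
Implicit Types (v : I -> H) (x y h : H).

(** A relation rather than a function: the sum determines S h only up to distance
    zero. *)
Definition is_frame_operator :=
  forall h, hsum (fun k => hdot h (u k) *: u k) (S h).

Context (uS : is_frame_operator).

Lemma frame_operatorD x y : heq (S (x + y)) (S x + S y).
Proof.
apply: hsum_unique (uS (x + y)) _.
apply: hsum_heq (heq_refl _) (hsumD (uS x) (uS y)) => k.
by rewrite hdotDl scalerDl; exact: heq_refl.
Qed.

Lemma frame_operatorZ c x : heq (S (c *: x)) (c *: S x).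
Proof.
apply: hsum_unique (uS (c *: x)) _.
apply: hsum_heq (heq_refl _) (hsumZ c (uS x)) => k.
by rewrite hdotZl scalerA; exact: heq_refl.
Qed.

Lemma frame_operator_heq x y : heq x y -> heq (S x) (S y).
Proof.
move=> xy; apply: hsum_unique (uS x) _.
apply: hsum_heq (heq_refl _) (uS y) => k.
by rewrite (heq_hdotl _ xy); exact: heq_refl.
Qed.

(** <S x, y> and <x, S y> are limits of the same finite sums
    of <x, u_k> <u_k, y>. *)
Lemma frame_operator_selfadjoint x y : hdot (S x) y = hdot x (S y).
Proof.
apply/eqP; rewrite -subr_eq0; apply/eqP/cmod_eq0/eqP.
rewrite eq_le cmod_ge0 andbT; apply/ler_addgt0Pl => e e0; rewrite addr0.
have e2 : 0 < e / 2 by rewrite divr_gt0.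
have [F1 h1] := hsum_hdot y (uS x) e2; have [F2 h2] := hsum_hdot x (uS y) e2.
have {h1} := h1 (F1 `|` F2)%fset (fsubsetUl _ _).
have {h2} := h2 (F1 `|` F2)%fset (fsubsetUr _ _).
set s2 := \sum_(_ <- _) _; set s1 := \sum_(_ <- _) _.
have -> : s2 = conjc s1.
  rewrite /s1 rmorph_sum /=; apply: eq_bigr => k _.
  by rewrite !hdotZl rmorphM /= -!hdotC mulrC.
rewrite (hdotC x) -rmorphB cmodJ => h2 h1.
have -> : hdot (S x) y - hdot x (S y) =
    hdot (S x) y - s1 + - (hdot x (S y) - s1) by ring.
by apply: le_trans (cmodD _ _) _; rewrite cmodN; lra.
Qed.

(** Applying U to the series of S h turns it, term by term, into a permutation
    of the series of S (U h): the phases cancel. *)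
Lemma frame_operator_commute (U : H -> H) (f g : I -> I) (c : I -> R[i]) h :
  (forall x y, U (x + y) = U x + U y) -> (forall a x, U (a *: x) = a *: U x) ->
  (forall x y, hdot (U x) (U y) = hdot x y) ->
  cancel f g -> cancel g f ->
  (forall k, U (u k) = c k *: u (f k)) -> (forall k, cmod (c k) = 1) ->
  heq (U (S h)) (S (U h)).
Proof.
move=> UD UZ Udot fK gK Uu c1.
have UuS : hsum (fun k => hdot (U h) (u (f k)) *: u (f k)) (U (S h)).
  have UB x y : U (x - y) = U x - U y.
    by rewrite UD -scaleN1r UZ scaleN1r.
  have : hsum (fun k => U (hdot h (u k) *: u k)) (U (S h)).
    apply: (@hsum_map _ _ _ _ U 1) (uS h) => x y.
      by rewrite UD; exact: heq_refl.
    by rewrite mul1r -UB /hnorm Udot.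
  apply: hsum_heq (heq_refl _) => k.
  rewrite UZ Uu -Udot Uu hdotZr scalerA mulrAC mulrC.
  have -> : conjc (c k) * c k = 1 by rewrite mulrC mul_conjc c1 expr1n.
  by rewrite mulr1; exact: heq_refl.
apply: hsum_unique (UuS) _.
by apply: (@hsum_reindex _ _ _ f g (fun k => hdot (U h) (u k) *: u k)).
Qed.

Context (lambda c : R).

Definition relax x := x - lambda%:C *: S x.

Context (contr : forall x, hnorm (relax x) <= c * hnorm x).

Lemma relaxD x y : heq (relax (x + y)) (relax x + relax y).
Proof.
rewrite /relax addrACA -opprD -scalerDr.
by apply: heqB (heq_refl _) (heqZ _ (frame_operatorD _ _)).
Qed.

Lemma relaxZ a x : heq (relax (a *: x)) (a *: relax x).
Proof.
rewrite /relax scalerBr !scalerA mulrC -scalerA.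
by apply: heqB (heq_refl _) (heqZ _ (frame_operatorZ _ _)).
Qed.

Lemma relax_lipschitz x y : hnorm (relax x - relax y) <= c * hnorm (x - y).
Proof.
have h0 : heq (relax x - relax y) (relax (x - y)).
  apply/heq_sym/(heq_trans (relaxD _ _))/(heqD (heq_refl _)).
  by have := relaxZ (-1) y; rewrite !scaleN1r.
apply: le_trans (contr _).
by have := hnormB_trans (relax x - relax y) (relax (x - y)) 0; rewrite !subr0 h0 add0r.
Qed.

Lemma relax_selfadjoint x y : hdot (relax x) y = hdot x (relax y).
Proof.
by rewrite hdotBl hdotBr hdotZl hdotZr conjc_real frame_operator_selfadjoint.
Qed.

(** Richardson iteration for the equation S y = x. *)
Definition relax_step x y := lambda%:C *: x + relax y.

Lemma relax_step_lipschitz x y z :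
  hnorm (relax_step x y - relax_step x z) <= c * hnorm (y - z).
Proof.
by rewrite opprD addrACA subrr add0r; exact: relax_lipschitz.
Qed.

Lemma relax_step_fixpoint x y : 0 < lambda ->
  heq (relax_step x y) y <-> heq (S y) x.
Proof.
move=> lambda_gt0; have e : relax_step x y - y = lambda%:C *: (x - S y).
  rewrite /relax_step /relax scalerBr addrAC -!addrA; congr (_ + _).
  by rewrite addrC addrAC subrr add0r.
rewrite /heq e hnormZ cmodR gtr0_norm // hnormC.
split=> [/eqP|->]; last by rewrite mulr0.
by rewrite mulf_eq0 gt_eqF //= => /eqP.
Qed.

Definition reconstructs (v w : I -> H) :=
  forall h, hsum (fun k => hdot h (v k) *: w k) h.

Section dual_step.
Context (v v' : I -> H).
Context (v'E : forall k, heq (v' k) (lambda%:C *: u k + relax (v k))).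

Lemma hdot_dual_step h k :
  hdot h (v' k) = lambda%:C * hdot h (u k) + hdot (relax h) (v k).
Proof. by rewrite (heq_hdotr _ (v'E k)) hdotDr hdotZr conjc_real relax_selfadjoint. Qed.

(** Term by term, the series is lambda times that of S h plus the image under
    I - lambda S of the expansion of h. *)
Lemma dual_step_reconstructs : reconstructs u v -> reconstructs u v'.
Proof.
move=> uv h.
have := hsumD (hsumZ lambda%:C (uS h)) (hsum_map relaxD relax_lipschitz (uv h)).
apply: hsum_heq => [k|]; last by rewrite /relax addrC subrK; exact: heq_refl.
apply: heq_sym; apply: heq_trans (heqZ _ (v'E k)) _; rewrite scalerDr.
by rewrite !scalerA mulrC; apply: heqD (heq_refl _) (heq_sym (relaxZ _ _)).
Qed.

Lemma dual_step_reconstructs_swap : reconstructs v u -> reconstructs v' u.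
Proof.
move=> vu h; have := hsumD (hsumZ lambda%:C (uS h)) (vu (relax h)).
apply: hsum_heq => [k|]; last by rewrite /relax addrC subrK; exact: heq_refl.
by rewrite hdot_dual_step scalerA -scalerDl; exact: heq_refl.
Qed.

Lemma dual_step_bessel B B' : bessel u B -> bessel v B' -> 0 <= B' ->
  bessel v' (2 * (lambda ^+ 2 * B + B' * c ^+ 2)).
Proof.
move=> uB vB B'0 h F.
have Th : hnorm (relax h) ^+ 2 <= (c * hnorm h) ^+ 2.
  by rewrite lerXn2r // ?nnegrE ?hnorm_ge0 // (le_trans (hnorm_ge0 _) (contr h)).
have := ler_wpM2l (sqr_ge0 lambda) (uB h F).
have := le_trans (vB (relax h) F) (ler_wpM2l B'0 Th).
set su := \sum_(k <- F) _; set sv := \sum_(k <- F) _ => hv hu.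
suff : \sum_(k <- F) cmod (hdot h (v' k)) ^+ 2 <= 2 * (lambda ^+ 2 * sv + su).
  by rewrite exprMn in hv; lra.
rewrite /su /sv !(mulr_sumr, mulrDr) -big_split /=; apply: ler_sum => k _.
rewrite hdot_dual_step !sqr_cmod !(Re_add, Im_add, Re_mul, Im_mul) /= !mul0r.
set a := Re _; set b := Im _; set p := Re _; set q := Im _.
rewrite -subr_ge0; have := sqr_ge0 (lambda * a - p); have := sqr_ge0 (lambda * b - q).
lra.
Qed.

End dual_step.

(** Pairing the expansion of h with h bounds the square norm of h by a sum of
    products <h, v_k> <u_k, h>; by the arithmetic-geometric mean inequality, half
    of the square norm is absorbed by the Bessel bound of u. *)
Lemma reconstructs_lower v B h (E : R) : 0 < B -> bessel u B ->
  reconstructs v u ->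
  (forall F : {fset I}, \sum_(k <- F) cmod (hdot h (v k)) ^+ 2 <= E) ->
  hnorm h ^+ 2 <= B * E.
Proof.
move=> B0 uB vu hE; apply/ler_addgt0Pl => e e0.
have e2 : 0 < e / 2 by rewrite divr_gt0.
have [F0 /(_ F0 (fsubset_refl _)) hF] := hsum_hdot h (vu h) e2.
have := le_lt_trans (Re_le_cmod _) hF; rewrite Re_add Re_opp -sqr_hnorm.
have := uB h F0; rewrite mulrC -ler_pdivrMr // mulrC => hB.
have := ler_wpM2l (ltW B0) (hE F0).
suff : Re (\sum_(k <- F0) hdot (hdot h (v k) *: u k) h) <=
    2^-1 * (B * (\sum_(k <- F0) cmod (hdot h (v k)) ^+ 2) +
    B^-1 * (\sum_(k <- F0) cmod (hdot h (u k)) ^+ 2)) by lra.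
rewrite Re_sum !mulr_sumr -big_split mulr_sumr /=.
apply: ler_sum => k _; rewrite hdotZl; apply: le_trans (Re_le_cmod _) _.
by rewrite cmodM (hdotC h) cmodJ; exact: mulr_le_mean.
Qed.

End frame_operator.

(** * Completeness of real mean square convergence *)

Section riesz_fischer.
Context d (T : measurableType d) (R : realType).
Context (mu : {measure set T -> \bar R}) (v : nat -> T -> R).
Implicit Types (x : T).

(** A weighted sum of squares of increments controls their absolute sum: each
    increment is at most a multiple of 2 ^- k. *)
Lemma cvg_of_weighted_squares (w : nat -> R) :
  (\sum_(k <oo) (4 ^+ k * (w k.+1 - w k) ^+ 2)%:E < +oo)%E -> cvgn w.
Proof.
set S := (\sum_(k <oo) _)%E => S_lty.
have t0 k : (0 <= (4 ^+ k * (w k.+1 - w k) ^+ 2)%:E)%E.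
  by rewrite lee_fin mulr_ge0 ?sqr_ge0 ?exprn_ge0.
have S0 : (0 <= S)%E by apply: nneseries_ge0 => k _ _.
have Sfin : S \is a fin_num by rewrite ge0_fin_numE.
pose C := Num.sqrt (fine S).
have wC k : `|telescope w k| <= geometric C 2^-1 k.
  have : ((4 ^+ k * (w k.+1 - w k) ^+ 2)%:E <= S)%E.
    apply: le_trans (nneseries_lim_ge k.+1 _) => //.
    by rewrite big_nat_recr //= leeDr // sume_ge0.
  rewrite -(fineK Sfin) lee_fin => h.
  rewrite /= /telescope -(@ler_pXn2r _ 2) ?nnegrE ?mulr_ge0 ?sqrtr_ge0 ?exprn_ge0 //.
  rewrite real_normK ?num_real // exprMn sqr_sqrtr ?fine_ge0 //.
  have -> : (2^-1 ^+ k) ^+ 2 = (4 ^+ k)^-1 :> R.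
    by rewrite exprAC -exprVn; congr (_ ^+ _); field.
  by rewrite ler_pdivlMr ?exprn_gt0 // mulrC.
suff : cvgn (series (telescope w)).
  rewrite telescopeK => h.
  rewrite (_ : w = (fun n => w n - w 0%N) \+ cst (w 0%N)); last first.
    by apply/funext => n /=; rewrite subrK.
  by apply: is_cvgD => //; exact: is_cvg_cst.
apply: normed_cvg; apply: series_le_cvg wC _ => //.
  by move=> k; rewrite /= mulr_ge0 ?sqrtr_ge0 ?exprn_ge0.
by apply: is_cvg_geometric_series; rewrite ger0_norm // invf_lt1 // ltr1n.
Qed.

(** A subsequence whose successive squared distances decrease like 8 ^- k
    converges almost everywhere, since the weights 4 ^ k leave the summable bound
    2 ^- k on the integrals of the increments; by Fatou's lemma its pointwise
    limit is the limit in mean square of the whole sequence. *)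
Lemma mean_square_complete : (forall n, measurable_fun setT (v n)) ->
  (forall eps : R, 0 < eps -> exists N, forall m n, (N <= m)%N -> (N <= n)%N ->
     (\int[mu]_x ((v m x - v n x) ^+ 2)%:E <= eps%:E)%E) ->
  exists f : T -> R, measurable_fun setT f /\
    forall eps : R, 0 < eps -> exists N, forall n, (N <= n)%N ->
     (\int[mu]_x ((v n x - f x) ^+ 2)%:E <= eps%:E)%E.
Proof.
move=> mv cauchy.
have e8 k : 0 < 8^-1 ^+ k :> R by rewrite exprn_gt0 // invr_gt0.
have [N hN] := choice (fun k => cauchy _ (e8 k)).
pose n_ k := (k + \sum_(i < k.+1) N i)%N.
have Nn k : (N k <= n_ k)%N.
  by rewrite /n_ big_ord_recr /= addnA leq_addl.
have nS k : (n_ k <= n_ k.+1)%N.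
  rewrite /n_ [X in (_ <= _ + X)%N]big_ord_recr /= addnA.
  by apply: leq_trans (leq_addr _ _); rewrite leq_add2r.
have kn k : (k <= n_ k)%N by rewrite leq_addr.
pose w k := v (n_ k).
pose t k x : \bar R := (4 ^+ k * (w k.+1 x - w k x) ^+ 2)%:E.
have mt k : measurable_fun setT (t k).
  apply/measurable_EFinP/measurable_funM => //.
  by apply: measurable_funX; apply: measurable_funB; exact: mv.
have t0 k x : (0 <= t k x)%E.
  by rewrite lee_fin mulr_ge0 ?sqr_ge0 ?exprn_ge0.
have msq (f g : T -> R) : measurable_fun setT f -> measurable_fun setT g ->
    measurable_fun setT (fun x => ((f x - g x) ^+ 2)%:E : \bar R).
  move=> mf mg; apply/measurable_EFinP; apply: measurable_funX.
  exact: measurable_funB.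
have tsum : (\int[mu]_x (\sum_(k <oo) t k x) <= 2%:E)%E.
  rewrite integral_nneseries //.
  apply: (@le_trans _ _ (\sum_(k <oo) (2^-1 ^+ k)%:E)%E).
    apply: lee_nneseries => [k _ _|k _]; first by apply: integral_ge0 => x _.
    under eq_integral do rewrite /t EFinM.
    rewrite ge0_integralZl_EFin ?exprn_ge0 //; last 2 first.
    - by move=> x _; rewrite lee_fin sqr_ge0.
    - exact: msq (mv _) (mv _).
    have -> : ((2^-1 ^+ k)%R%:E = (4 ^+ k)%R%:E * (8^-1 ^+ k)%R%:E :> \bar R)%E.
      by rewrite -EFinM -exprMn; congr ((_ ^+ _)%:E); field.
    rewrite lee_pmul2l ?lte_fin ?exprn_gt0 //.
    by apply: hN; [exact: leq_trans (Nn k) (nS k)|exact: Nn].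
  apply: lime_le; first by apply: is_cvg_nneseries => k _ _; rewrite lee_fin exprn_ge0.
  apply: nearW => n; rewrite sumEFin lee_fin.
  suff : \sum_(0 <= k < n) 2^-1 ^+ k + 2 * 2^-1 ^+ n <= 2 :> R.
    by apply: le_trans; rewrite lerDl mulr_ge0 // exprn_ge0.
  elim: n => [|n IH]; first by rewrite big_geq // add0r mulr1.
  apply: le_trans IH; rewrite big_nat_recr //= exprS.
  set a := \sum_(_ <= _ < _) _; set b := _ ^+ n; lra.
have ae_cvg : {ae mu, forall x, cvgn (w ^~ x)}.
  have /integrable_ae : mu.-integrable setT (fun x => \sum_(k <oo) t k x)%E.
    apply/integrableP; split.
      by apply: ge0_emeasurable_sum.
    under eq_integral do rewrite gee0_abs ?nneseries_ge0 //.
    by apply: le_lt_trans tsum _; rewrite ltry.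
  move=> /(_ measurableT); apply: filterS => x /(_ I) h.
  apply: cvg_of_weighted_squares; rewrite -ge0_fin_numE //.
  by apply: nneseries_ge0 => k _ _; exact: t0.
pose f x : R := fine (limn_esup (fun k => (w k x)%:E)).
have mf : measurable_fun setT f.
  apply: (measurableT_comp (@fine_measurable _ _ measurableT)).
  by apply: measurable_fun_limn_esup => k; apply/measurable_EFinP; exact: mv.
exists f; split=> // e e0; have [M hM] := cauchy e e0; exists M => n Mn.
pose q k x : \bar R := ((v n x - w k x) ^+ 2)%:E.
have mq k : measurable_fun setT (q k) by exact: msq (mv _) (mv _).
have q0 k x : (0 <= q k x)%E by rewrite lee_fin sqr_ge0.
apply: (@le_trans _ _ (\int[mu]_x limn_einf (q ^~ x))%E).
  apply: ae_ge0_le_integral => //.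
  - by move=> x _; rewrite lee_fin sqr_ge0.
  - exact: msq.
  - move=> x _; rewrite limn_einf_lim.
    apply: lime_ge.
      by apply/cvg_ex; eexists; apply/ereal_nondecreasing_cvgn/nondecreasing_einfs.
    apply: nearW => k; apply: le_ereal_inf_tmp => _ [j _ <-]; exact: q0.
  - rewrite (_ : (fun x => _) = (fun x => - limn_esup (-%E \o q ^~ x))%E); last first.
      by apply/funext => x; rewrite limn_esupN oppeK.
    apply: measurableT_comp => //; apply: measurable_fun_limn_esup => k.
    exact: measurableT_comp.
  - apply: filterS ae_cvg => x cx _.
    have wE : (fun k => (w k x)%:E) @ \oo --> (limn (w ^~ x))%:E.
      by apply: cvg_EFin; [exact: nearW|exact: cx].
    have -> : f x = limn (w ^~ x).
      by rewrite /f is_cvg_limn_esupE ?(cvg_lim _ wE) //;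
         apply/cvg_ex; eexists; exact: wE.
    have qE : q ^~ x @ \oo --> ((v n x - limn (w ^~ x)) ^+ 2)%:E.
      apply: cvg_EFin; first exact: nearW.
      have wB : (fun k => v n x - w k x) @ \oo --> v n x - limn (w ^~ x).
        by apply: cvgB cx; exact: cvg_cst.
      exact: (cvgM wB wB).
    by rewrite is_cvg_limn_einfE ?(cvg_lim _ qE) //; apply/cvg_ex; eexists; exact: qE.
apply: le_trans (fatou _ _ _ _) _ => //.
rewrite limn_einf_lim; apply: lime_le.
  by apply/cvg_ex; eexists; apply/ereal_nondecreasing_cvgn/nondecreasing_einfs.
exists M => // k /= Mk; apply: le_trans (ereal_inf_lbound _) (hM n (n_ k) Mn _).
  by exists k => /=.
exact: leq_trans (kn k).
Qed.

End riesz_fischer.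

(** * The space of complex square integrable functions *)

Section L2_space.
Context {R : realType}.
Local Notation mu := (@lebesgue_measure R).
Local Notation mfun := (@measurable_fun _ _ (measurableTypeR R) R setT).
Implicit Types (f g h : R -> R[i]) (p q : R -> R).

Definition sqmod f : R -> R := fun x => Re (f x) ^+ 2 + Im (f x) ^+ 2.

Lemma sqmod_ge0 f x : 0 <= sqmod f x.
Proof. by rewrite addr_ge0 ?sqr_ge0. Qed.

Lemma measurable_sqmod f : mfun (fun x => Re (f x)) ->
  mfun (fun x => Im (f x)) -> mfun (sqmod f).
Proof. by move=> mr mi; apply: measurable_funD; exact: measurable_funX. Qed.

Lemma L2normE f : L2norm f = ((\int[mu]_x (sqmod f x)%:E) `^ 2^-1)%E.
Proof.
rewrite /L2norm unlock; congr (_ `^ _)%E; apply: eq_integral => x _.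
rewrite abse_EFin poweR_EFin powR_mulrn ?normr_ge0 //.
by rewrite real_normK ?num_real // sqr_cmod.
Qed.

Lemma L2P f : L2 f <->
  [/\ mfun (fun x => Re (f x)),
      mfun (fun x => Im (f x)) &
      mu.-integrable setT (EFin \o sqmod f)].
Proof.
have normE : (\int[mu]_x `|(EFin \o sqmod f) x| = \int[mu]_x (sqmod f x)%:E)%E.
  by apply: eq_integral => x _ /=; rewrite ger0_norm ?sqmod_ge0.
split=> -[mr mi]; rewrite /= ?L2normE => h; split=> //.
  apply/integrableP; split.
    by apply/measurable_EFinP; exact: measurable_sqmod.
  by rewrite normE; apply: lty_poweRy h.
by rewrite L2normE poweR_lty // -normE; case/integrableP: h.
Qed.

Lemma L2norm_Rintegral f : L2 f ->
  L2norm f = (Num.sqrt (\int[mu]_x sqmod f x))%:E.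
Proof.
move=> /L2P[_ _ fi]; rewrite L2normE -powR12_sqrt ?Rintegral_ge0 //; last first.
  by move=> x _; exact: sqmod_ge0.
by rewrite -poweR_EFin fineK // integrable_fin_num.
Qed.

Lemma integrable_le_sqmod f g p : L2 f -> L2 g -> mfun p ->
  (forall x, `|p x| <= 2 * (sqmod f x + sqmod g x)) ->
  mu.-integrable setT (EFin \o p).
Proof.
move=> /L2P[_ _ fi] /L2P[_ _ gi] mp le_p.
have fg : mu.-integrable setT (EFin \o (fun x => 2 * (sqmod f x + sqmod g x))).
  by apply: (@eq_integrable _ (measurableTypeR R) R mu setT measurableT _ _ _
    (integrableZl measurableT 2 (integrableD measurableT fi gi))).
apply: (@le_integrable _ (measurableTypeR R) R mu setT measurableT (EFin \o p) _ _ _ fg).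
  exact/measurable_EFinP.
by move=> x _; rewrite lee_fin; apply: le_trans (le_p x) (ler_norm _).
Qed.

Lemma L2_le f g h : mfun (fun x => Re (h x)) ->
  mfun (fun x => Im (h x)) -> L2 f -> L2 g ->
  (forall x, sqmod h x <= 2 * (sqmod f x + sqmod g x)) -> L2 h.
Proof.
move=> mr mi Lf Lg le_h; apply/L2P; split=> //.
apply: (integrable_le_sqmod Lf Lg) => [|x]; first exact: measurable_sqmod.
by rewrite ger0_norm ?sqmod_ge0.
Qed.

Lemma L2_zero : L2 (fun _ => 0 : R[i]).
Proof.
apply/L2P; split=> //=.
rewrite (_ : _ \o _ = cst 0%E); first exact: integrable0.
by apply/funext => x; rewrite /sqmod /= expr0n addr0.
Qed.

Lemma L2_add f g : L2 f -> L2 g -> L2 (fun x => f x + g x).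
Proof.
move=> Lf Lg; have /L2P[fr fi _] := Lf; have /L2P[gr gi _] := Lg.
apply: (L2_le _ _ Lf Lg) => [||x].
- by under eq_fun do rewrite Re_add; exact: measurable_funD.
- by under eq_fun do rewrite Im_add; exact: measurable_funD.
rewrite /sqmod Re_add Im_add -subr_ge0.
have := sqr_ge0 (Re (f x) - Re (g x)); have := sqr_ge0 (Im (f x) - Im (g x)); lra.
Qed.

Lemma L2_scale c f : L2 f -> L2 (fun x => c * f x).
Proof.
move=> /L2P[fr fi ff]; apply/L2P; split.
- by under eq_fun do rewrite Re_mul; apply: measurable_funB; exact: measurable_funM.
- by under eq_fun do rewrite Im_mul; apply: measurable_funD; exact: measurable_funM.
rewrite (_ : _ \o _ = fun x => ((cmod c ^+ 2)%:E * (EFin \o sqmod f) x)%E).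
  exact: integrableZl.
apply/funext => x; rewrite /= -EFinM; congr (_%:E).
by rewrite /sqmod -!sqr_cmod cmodM exprMn.
Qed.

Definition dotf f g : R -> R[i] := fun x => f x * conjc (g x).

Lemma L2dotE f g :
  L2dot f g = (\int[mu]_x Re (dotf f g x)) +i* (\int[mu]_x Im (dotf f g x)).
Proof. by []. Qed.

Lemma integrable_dotf f g : L2 f -> L2 g ->
  mu.-integrable setT (EFin \o (fun x => Re (dotf f g x))) /\
  mu.-integrable setT (EFin \o (fun x => Im (dotf f g x))).
Proof.
move=> Lf Lg; have /L2P[fr fi _] := Lf; have /L2P[gr gi _] := Lg.
have bound a b c d : `|a * b + c * d| <= 2 * (a ^+ 2 + c ^+ 2 + (b ^+ 2 + d ^+ 2)) :> R.
  rewrite ler_norml; have := sqr_ge0 (a - b); have := sqr_ge0 (c - d).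
  have := sqr_ge0 (a + b); have := sqr_ge0 (c + d); have := sqr_ge0 a.
  have := sqr_ge0 b; have := sqr_ge0 c; have := sqr_ge0 d => *; apply/andP; split; lra.
split; apply: (integrable_le_sqmod Lf Lg) => [|x].
- under eq_fun do rewrite Re_mul Re_conjc Im_conjc mulrN opprK.
  by apply: measurable_funD; exact: measurable_funM.
- by rewrite Re_mul Re_conjc Im_conjc mulrN opprK; exact: bound.
- under eq_fun do rewrite Im_mul Re_conjc Im_conjc mulrN.
  apply: measurable_funD; last exact: measurable_funM.
  by apply: measurableT_comp => //; exact: measurable_funM.
- rewrite Im_mul Re_conjc Im_conjc mulrN -mulNr addrC /sqmod.
  by rewrite [X in _ <= _ * (X + _)]addrC -(sqrrN (Re (f x))); exact: bound.
Qed.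

Record L2fun := MkL2fun { L2val :> R -> R[i]; L2valP : L2 L2val }.

Lemma L2val_inj : injective L2val.
Proof.
by case=> f Lf [g Lg] /= fg; subst g; congr MkL2fun; exact: Prop_irrelevance.
Qed.

HB.instance Definition _ := gen_eqMixin L2fun.
HB.instance Definition _ := gen_choiceMixin L2fun.

Definition L2fun_zero := MkL2fun L2_zero.
Definition L2fun_add (x y : L2fun) := MkL2fun (L2_add (L2valP x) (L2valP y)).
Definition L2fun_scale c (x : L2fun) := MkL2fun (L2_scale c (L2valP x)).
Definition L2fun_opp (x : L2fun) := L2fun_scale (-1) x.

Lemma L2fun_addA : associative L2fun_add.
Proof. by move=> x y z; apply/L2val_inj/funext => t /=; rewrite addrA. Qed.
Lemma L2fun_addC : commutative L2fun_add.
Proof. by move=> x y; apply/L2val_inj/funext => t /=; rewrite addrC. Qed.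
Lemma L2fun_add0 : left_id L2fun_zero L2fun_add.
Proof. by move=> x; apply/L2val_inj/funext => t /=; rewrite add0r. Qed.
Lemma L2fun_addN : left_inverse L2fun_zero L2fun_opp L2fun_add.
Proof. by move=> x; apply/L2val_inj/funext => t /=; rewrite mulN1r addNr. Qed.

HB.instance Definition _ := GRing.isZmodule.Build L2fun
  L2fun_addA L2fun_addC L2fun_add0 L2fun_addN.

Lemma L2fun_scaleA a b (x : L2fun) :
  L2fun_scale a (L2fun_scale b x) = L2fun_scale (a * b) x.
Proof. by apply/L2val_inj/funext => t /=; rewrite mulrA. Qed.
Lemma L2fun_scale1 : left_id 1 L2fun_scale.
Proof. by move=> x; apply/L2val_inj/funext => t /=; rewrite mul1r. Qed.
Lemma L2fun_scaleDr : right_distributive L2fun_scale +%R.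
Proof. by move=> c x y; apply/L2val_inj/funext => t /=; rewrite mulrDr. Qed.
Lemma L2fun_scaleDl (x : L2fun) :
  {morph L2fun_scale^~ x : a b / a + b}.
Proof. by move=> a b; apply/L2val_inj/funext => t /=; rewrite mulrDl. Qed.

HB.instance Definition _ := GRing.Zmodule_isLmodule.Build R[i] L2fun
  L2fun_scaleA L2fun_scale1 L2fun_scaleDr L2fun_scaleDl.

Implicit Types (x y z : L2fun).

Lemma measurable_L2Re x : mfun (fun t => Re (x t)).
Proof. by have /L2P[] := L2valP x. Qed.

Lemma measurable_L2Im x : mfun (fun t => Im (x t)).
Proof. by have /L2P[] := L2valP x. Qed.

Lemma measurable_L2sqmod x : mfun (sqmod x).
Proof. exact: measurable_sqmod (measurable_L2Re x) (measurable_L2Im x). Qed.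

Lemma L2valB x y t : (x - y) t = x t - y t.
Proof. by rewrite /= mulN1r. Qed.

Lemma L2val_sum (I : Type) (s : seq I) (F : I -> L2fun) t :
  (\sum_(i <- s) F i) t = \sum_(i <- s) F i t.
Proof. by elim/big_rec2: _ => // i _ x _ <-. Qed.

Lemma L2dotDl x y z : L2dot (x + y) z = L2dot x z + L2dot y z.
Proof.
have [xr xi] := integrable_dotf (L2valP x) (L2valP z).
have [yr yi] := integrable_dotf (L2valP y) (L2valP z).
rewrite !L2dotE; apply/eqP; rewrite eq_complex /= -!RintegralD //.
apply/andP; split; apply/eqP; apply: eq_Rintegral => t _.
  by rewrite -Re_add -mulrDl.
by rewrite -Im_add -mulrDl.
Qed.

Lemma L2dotZl c x z : L2dot (c *: x) z = c * L2dot x z.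
Proof.
have [xr xi] := integrable_dotf (L2valP x) (L2valP z).
have iZ (a : R) (q : R -> R) : mu.-integrable setT (EFin \o q) ->
    mu.-integrable setT (EFin \o (fun t => a * q t)).
  by move=> iq; apply: eq_integrable (integrableZl measurableT a iq).
rewrite !L2dotE; apply/eqP; rewrite eq_complex Re_mul Im_mul /=.
rewrite -!RintegralZl // -RintegralB //; try exact: iZ.
rewrite -RintegralD //; try exact: iZ.
apply/andP; split; apply/eqP; apply: eq_Rintegral => t _.
  by rewrite -Re_mul mulrA.
by rewrite -Im_mul mulrA.
Qed.

Lemma L2dotC x y : L2dot y x = conjc (L2dot x y).
Proof.
have [xr xi] := integrable_dotf (L2valP x) (L2valP y).
rewrite !L2dotE; apply/eqP; rewrite eq_complex /= -mulN1r -RintegralZl //.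
have e t : dotf y x t = conjc (dotf x y t).
  by rewrite /dotf rmorphM /= conjcK mulrC.
apply/andP; split; apply/eqP; apply: eq_Rintegral => t _; rewrite e.
  by rewrite Re_conjc.
by rewrite Im_conjc mulN1r.
Qed.

Lemma Re_L2dot x : Re (L2dot x x) = \int[mu]_t sqmod x t.
Proof.
rewrite L2dotE /=; apply: eq_Rintegral => t _.
by rewrite Re_mul Re_conjc Im_conjc mulrN opprK -!expr2.
Qed.

Lemma Re_L2dot_ge0 x : 0 <= Re (L2dot x x).
Proof. by rewrite Re_L2dot Rintegral_ge0 // => t _; exact: sqmod_ge0. Qed.

Lemma integral_sqmodB x y : (\int[mu]_t (sqmod (x - y)%R t)%:E =
  (Re (L2dot (x - y)%R (x - y)%R))%:E)%E.
Proof.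
rewrite Re_L2dot fineK // integrable_fin_num //.
by have /L2P[_ _] := L2valP (x - y).
Qed.

(** Completeness is inherited from the real and imaginary parts. *)
Lemma L2fun_complete (v : nat -> L2fun) :
  (forall eps, 0 < eps -> exists N, forall m n, (N <= m)%N -> (N <= n)%N ->
     Re (L2dot (v m - v n) (v m - v n)) < eps) ->
  exists l : L2fun, forall eps, 0 < eps -> exists N, forall n, (N <= n)%N ->
     Re (L2dot (v n - l) (v n - l)) < eps.
Proof.
move=> cauchy.
have part (F : R[i] -> R) : (forall z w : R[i], F (z - w) = F z - F w) ->
    (forall z : R[i], F z ^+ 2 <= Re z ^+ 2 + Im z ^+ 2) ->
    (forall n, mfun (fun t => F (v n t))) ->
    exists f : R -> R, mfun f /\
    forall eps : R, 0 < eps -> exists N, forall n, (N <= n)%N ->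
     (\int[mu]_x ((F (v n x) - f x) ^+ 2)%:E <= eps%:E)%E.
  move=> FB F_le mF.
  apply: (@mean_square_complete _ (measurableTypeR R) R mu
    (fun n t => F (v n t))) => // eps /cauchy[N hN].
  exists N => m n Nm Nn; have := ltW (hN m n Nm Nn).
  rewrite -lee_fin -integral_sqmodB; apply: le_trans; apply: ge0_le_integral => //.
  - by move=> t _; rewrite lee_fin sqr_ge0.
  - by apply/measurable_EFinP; apply: measurable_funX; exact: measurable_funB.
  - by apply/measurable_EFinP; exact: measurable_L2sqmod.
  - by move=> t _; rewrite lee_fin -FB /sqmod L2valB.
have [|||fr [mfr hr]] := part (@Re R).
- by move=> z w; rewrite Re_add Re_opp.
- by move=> z; rewrite lerDl sqr_ge0.
- by move=> n; exact: measurable_L2Re.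
have [|||fi [mfi hi]] := part (@Im R).
- by move=> z w; rewrite Im_add Im_opp.
- by move=> z; rewrite lerDr sqr_ge0.
- by move=> n; exact: measurable_L2Im.
pose f t := fr t +i* fi t.
have mrd n : mfun (fun t => Re (v n t - f t)).
  under eq_fun do rewrite Re_add Re_opp.
  by apply: measurable_funB => //; exact: measurable_L2Re.
have mid n : mfun (fun t => Im (v n t - f t)).
  under eq_fun do rewrite Im_add Im_opp.
  by apply: measurable_funB => //; exact: measurable_L2Im.
have int_diff eps : 0 < eps -> exists N, forall n, (N <= n)%N ->
    (\int[mu]_t (sqmod (fun t => v n t - f t) t)%:E <= eps%:E)%E.
  move=> e0; have e2 : 0 < eps / 2 by rewrite divr_gt0.
  have [N1 h1] := hr _ e2; have [N2 h2] := hi _ e2.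
  exists (maxn N1 N2) => n; rewrite geq_max => /andP[/h1 {}h1 /h2 {}h2].
  have := leeD h1 h2; rewrite -EFinD -splitr -ge0_integralD //=.
  - apply: le_trans; apply: ge0_le_integral => //.
    + by move=> t _; rewrite lee_fin sqmod_ge0.
    + by apply/measurable_EFinP; exact: measurable_sqmod (mrd n) (mid n).
    + apply: emeasurable_funD; apply/measurable_EFinP; apply: measurable_funX.
        by apply: measurable_funB => //; exact: measurable_L2Re.
      by apply: measurable_funB => //; exact: measurable_L2Im.
    + by move=> t _; rewrite -EFinD lee_fin /sqmod !(Re_add, Im_add, Re_opp, Im_opp).
  - by move=> t _; rewrite lee_fin sqr_ge0.
  - apply/measurable_EFinP; apply: measurable_funX.
    by apply: measurable_funB => //; exact: measurable_L2Re.
  - by move=> t _; rewrite lee_fin sqr_ge0.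
  - apply/measurable_EFinP; apply: measurable_funX.
    by apply: measurable_funB => //; exact: measurable_L2Im.
have [N /(_ N (leqnn N)) hN] := int_diff 1 ltr01.
have Ld : L2 (fun t => v N t - f t).
  apply/L2P; split=> //; apply/integrableP; split.
    by apply/measurable_EFinP; exact: measurable_sqmod (mrd N) (mid N).
  apply: le_lt_trans (ltry 1); apply: le_trans hN.
  by under eq_integral do rewrite /= ger0_norm ?sqmod_ge0 //.
pose l : L2fun := v N - MkL2fun Ld.
have lE t : l t = f t by rewrite L2valB /= opprB addrC subrK.
exists l => eps e0; have [M hM] := int_diff (eps / 2) (divr_gt0 e0 (ltr0Sn _ 1)).
exists M => n /hM h; rewrite -lte_fin -integral_sqmodB.
apply: (@le_lt_trans _ _ (eps / 2)%:E); last by rewrite lte_fin; lra.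
apply: le_trans h; rewrite le_eqVlt; apply/orP; left; apply/eqP.
by apply: eq_integral => t _; rewrite /sqmod L2valB lE.
Qed.

End L2_space.

Arguments L2fun : clear implicits.

Definition L2space (R : realType) : semiHilbert R :=
  @SemiHilbert R (L2fun R) (fun x y => L2dot x y) (@L2dotDl R) (@L2dotZl R)
    (@L2dotC R) (@Re_L2dot_ge0 R) (@L2fun_complete R).

(** * Translation invariance of the Lebesgue integral *)

Section translation.
Context {R : realType}.
Local Notation mu := (@lebesgue_measure R).
Local Notation TR := (measurableTypeR R).
Implicit Types (q : R -> R) (t : R).

Lemma measurable_shift t :
  measurable_fun (setT : set TR) ((fun x => x - t) : TR -> TR).
Proof. exact: measurable_funB. Qed.

Lemma lebesgue_measure_shift t (A : set R) : measurable A ->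
  pushforward mu ((fun x => x - t) : TR -> TR) A = mu A.
Proof.
move=> mA; apply/esym; apply: lebesgue_measure_unique => //=.
  exact: measurable_shift.
move=> mphi _ [[a b]] _ <-.
rewrite /pushforward (_ : _ @^-1` _ = `]a + t, b + t]%classic); last first.
  by apply/seteqP; split=> x /=; rewrite !in_itv /= ltrBrDr lerBlDr.
by rewrite !lebesgue_measure_itv /= !lte_fin ltrD2r -!EFinB opprD addrACA subrr addr0.
Qed.

Lemma integral_shift t (q : R -> \bar R) : measurable_fun (setT : set TR) q ->
  (forall x, 0 <= q x)%E -> (\int[mu]_x q ((x : R) - t)%R = \int[mu]_x q x)%E.
Proof.
move=> mq q0.
rewrite -[LHS](@ge0_integral_pushforward _ _ TR TR R _ (measurable_shift t) mu setT) //.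
apply: eq_measure_integral; first exact: measurable_shift.
by move=> mphi A mA _; exact: lebesgue_measure_shift.
Qed.

Lemma integrable_shift t q : mu.-integrable setT (EFin \o q) ->
  mu.-integrable setT (EFin \o (fun x => q (x - t))).
Proof.
move=> /integrableP[mq qoo]; apply/integrableP; split.
  exact: (measurableT_comp mq (measurable_shift t)).
by rewrite /= (@integral_shift t (fun x => `|(q x)%:E|)%E) //; exact: measurableT_comp.
Qed.

Lemma Rintegral_shift t q : mu.-integrable setT (EFin \o q) ->
  \int[mu]_x q (x - t) = \int[mu]_x q x.
Proof.
move=> qi; congr fine; have /integrableP[mq _] := qi.
rewrite -[LHS](@integral_pushforward _ _ TR TR R _ (measurable_shift t) mu setT
  (EFin \o q) mq (integrable_shift t qi)) //.
apply: eq_measure_integral; first exact: measurable_shift.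
by move=> mphi A mA _; exact: lebesgue_measure_shift.
Qed.

End translation.

(** * Square integrable functions as vectors *)

Section bridges.
Context {R : realType}.
Local Notation mu := (@lebesgue_measure R).
Local Notation H := (L2space R).
Implicit Types (x y : H).

Lemma L2norm_hnorm x : L2norm (L2val x) = (hnorm x)%:E.
Proof. by rewrite L2norm_Rintegral ?Re_L2dot -?Re_L2dot //; exact: L2valP. Qed.

Lemma L2norm_sqr x : (L2norm (L2val x) ^+ 2)%E = (hnorm x ^+ 2)%:E.
Proof. by rewrite L2norm_hnorm EFin_expe. Qed.

Lemma L2sum_hsum (I : choiceType) (u : I -> H) s :
  L2sum (fun k => L2val (u k)) (L2val s) <-> hsum u s.
Proof.
have e F : (fun t => (L2val s t - \sum_(k <- F) L2val (u k) t)%R) =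
    L2val (s - \sum_(k <- F) u k).
  by apply/funext => t; rewrite L2valB L2val_sum.
split=> us eps e0; have [F0 h0] := us eps e0; exists F0 => F /h0.
  by rewrite e L2norm_hnorm lte_fin.
by rewrite e L2norm_hnorm lte_fin.
Qed.

Lemma ae_imply (P Q : R -> Prop) : (forall t, P t -> Q t) ->
  {ae mu, forall t, P t} -> {ae mu, forall t, Q t}.
Proof.
move=> PQ [N [mN N0 PN]]; exists N; split=> // t /= nQ.
by apply: PN => /= /PQ.
Qed.

Lemma heq_ae x y : heq x y <-> {ae mu, forall t, L2val x t = L2val y t}.
Proof.
have sE : (\int[mu]_t `|(sqmod (L2val (x - y)) t)%:E| = (hnorm (x - y) ^+ 2)%:E)%E.
  rewrite sqr_hnorm -integral_sqmodB; apply: eq_integral => t _.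
  by rewrite gee0_abs // lee_fin sqmod_ge0.
have ms : measurable_fun (setT : set (measurableTypeR R))
    (EFin \o sqmod (L2val (x - y))).
  by apply/measurable_EFinP; exact: measurable_L2sqmod.
have aeP := ae_eq_integral_abs mu measurableT ms.
split=> [xy|xy].
  have : ae_eq mu setT (EFin \o sqmod (L2val (x - y))) (cst 0%E).
    by apply/aeP; rewrite sE xy expr0n.
  apply: ae_imply => t /(_ I) [+]; rewrite /sqmod -sqr_cmod => /eqP.
  rewrite sqrf_eq0 => /eqP/cmod_eq0/eqP.
  by rewrite mulN1r subr_eq0 => /eqP.
apply/eqP; rewrite -(@sqrf_eq0 R) -eqe -sE; apply/eqP/aeP.
move: xy; apply: ae_imply => t xyt _; rewrite /= /sqmod /= mulN1r xyt subrr /=.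
by rewrite expr0n addr0.
Qed.

End bridges.

Section frames_bridge.
Context {R : realType}.
Local Notation H := (L2space R).

Lemma esum_EFin_leP (I : choiceType) (f : I -> R) (E : R) :
  (\esum_(k in setT) (f k)%:E <= E%:E)%E <->
  forall F : {fset I}, \sum_(k <- F) f k <= E.
Proof.
split=> [le_E F|le_E].
  rewrite -lee_fin; apply: le_trans le_E; apply: esum_ge; exists [set` F].
    by split=> //; exact: finite_fset.
  by rewrite -fsbig_seq ?fset_uniq // sumEFin.
apply: ge_ereal_sup => _ [X [finX _] <-].
by rewrite fsbig_finite // sumEFin lee_fin.
Qed.

Context {I : countType}.
Implicit Types (u v : I -> H).

Lemma frame_bessel u : is_frame (fun k => L2val (u k)) ->
  exists2 B, 0 < B & bessel u B.
Proof.
move=> [_ [A [B [_ B0 AB]]]]; exists B => // h.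
apply/(esum_EFin_leP (fun k => cmod (hdot h (u k)) ^+ 2)).
have /andP[_] := AB (L2val h) (L2valP h).
by rewrite L2norm_sqr -EFinM.
Qed.

(** What is left of duality once lower frame bounds, which follow from the
    expansions, are set aside. *)
Definition bessel_dual u v := [/\ exists2 B, 0 < B & bessel v B,
  reconstructs u v & reconstructs v u].

Lemma dual_frame_bessel_dual u v :
  is_dual_frame (fun k => L2val (u k)) (fun k => L2val (v k)) ->
  bessel_dual u v.
Proof.
move=> [/frame_bessel vB rec]; split=> // h; apply/L2sum_hsum.
  by have [] := rec (L2val h) (L2valP h).
by have [] := rec (L2val h) (L2valP h).
Qed.

(** The lower frame bound of v comes for free from the expansion of h in the
    Bessel family u. *)
Lemma bessel_dual_frame u v B : 0 < B -> bessel u B -> bessel_dual u v ->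
  is_dual_frame (fun k => L2val (u k)) (fun k => L2val (v k)).
Proof.
move=> B0 uB [[B' B'0 vB'] uv vu]; split; last first.
  move=> h Lh; split.
    by have /L2sum_hsum := uv (MkL2fun Lh).
  by have /L2sum_hsum := vu (MkL2fun Lh).
split; first by move=> k; exact: L2valP.
exists B^-1, B'; split; rewrite ?invr_gt0 // => h Lh.
pose x : H := MkL2fun Lh; rewrite -[h]/(L2val x) L2norm_sqr -!EFinM.
pose f k := cmod (hdot x (v k)) ^+ 2; rewrite -[X in (_ <= X <= _)%E]/
  (\esum_(k in setT) (f k)%:E)%E.
have f_le : (\esum_(k in setT) (f k)%:E <= (B' * hnorm x ^+ 2)%:E)%E.
  by apply/esum_EFin_leP; exact: vB'.
rewrite f_le andbT; set E := (\esum_(k in setT) _)%E in f_le *.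
have E0 : (0 <= E)%E by apply: esum_ge0 => k _; rewrite lee_fin sqr_ge0.
have Efin : E \is a fin_num.
  by rewrite ge0_fin_numE //; apply: le_lt_trans f_le (ltry _).
rewrite -(fineK Efin) lee_fin ler_pdivrMl //.
apply: (reconstructs_lower B0 uB vu) => F.
by move: F; apply/esum_EFin_leP; rewrite fineK.
Qed.

Lemma frame_op_frame_operator u B : 0 < B -> bessel u B ->
  exists2 S : H -> H, is_frame_operator u S &
    forall h : H, L2val (S h) = frame_op (fun k => L2val (u k)) (L2val h).
Proof.
move=> B0 uB.
have ex h : exists s : H, hsum (fun k => hdot h (u k) *: u k) s /\
    L2val s = frame_op (fun k => L2val (u k)) (L2val h).
  have [s hs] := bessel_summable h B0 uB.
  have [Lo so] : L2 (frame_op (fun k => L2val (u k)) (L2val h)) /\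
      L2sum (fun k x => L2dot (L2val h) (L2val (u k)) * L2val (u k) x)
        (frame_op (fun k => L2val (u k)) (L2val h)).
    apply: (@xgetPex _ _ [set s | L2 s /\ L2sum _ s]).
    exists (L2val s); split; first exact: L2valP.
    exact/(L2sum_hsum (fun k => hdot h (u k) *: u k)).
  by exists (MkL2fun Lo); split=> //; apply/L2sum_hsum.
by have [S hS] := choice ex; exists S => h; have [] := hS h.
Qed.

(** Homogeneity turns the bound on the unit ball into a bound on all vectors; a
    vector of norm zero cannot be normalized and is treated apart. *)
Lemma opnorm_relax u S lambda :
  is_frame_operator u S ->
  (forall h : H, L2val (S h) = frame_op (fun k => L2val (u k)) (L2val h)) ->
  (opnorm (id_sub_scaled lambda (frame_op (fun k => L2val (u k)))) < 1)%E ->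
  exists2 c, 0 <= c < 1 & forall h, hnorm (relax S lambda h) <= c * hnorm h.
Proof.
move=> uS SE; set T := id_sub_scaled _ _ => T_lt1.
have TE (h : H) : T (L2val h) = L2val (relax S lambda h).
  by apply/funext => t; rewrite /T /id_sub_scaled -SE /= mulN1r.
have ub (h : H) : hnorm h <= 1 -> ((hnorm (relax S lambda h))%:E <= opnorm T)%E.
  move=> h1; apply: ereal_sup_ubound; exists (L2val h).
    by split; [exact: L2valP|rewrite /= L2norm_hnorm lee_fin].
  by rewrite TE L2norm_hnorm.
have T_ge0 : (0 <= opnorm T)%E.
  apply: le_trans (ub 0 _); first by rewrite lee_fin hnorm_ge0.
  by rewrite hnorm0.
have Tfin : opnorm T \is a fin_num.
  by rewrite ge0_fin_numE //; apply: lt_trans T_lt1 (ltry _).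
exists (fine (opnorm T)).
  by rewrite fine_ge0 //= -lte_fin fineK.
move=> h; have [h0|hn0] := eqVneq (hnorm h) 0.
  have h00 : heq h (0 *: h) by rewrite /heq scale0r subr0.
  have Sh0 : heq (S h) 0.
    apply: heq_trans (frame_operator_heq uS h00) _.
    by have := frame_operatorZ uS 0 h; rewrite [in X in heq _ X]scale0r.
  have : heq (relax S lambda h) 0.
    have := heqB h00 (heqZ lambda%:C Sh0).
    by rewrite scale0r scaler0 subr0.
  by rewrite /heq subr0 => ->; rewrite h0 mulr0.
have h_gt0 : 0 < hnorm h by rewrite lt_neqAle eq_sym hn0 hnorm_ge0.
have := ub ((hnorm h)^-1%:C *: h).
rewrite hnormZ cmodR gtr0_norm ?invr_gt0 // mulVf // => /(_ (lexx _)).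
have := relaxZ uS lambda (hnorm h)^-1%:C h => eqZ.
have -> : hnorm (relax S lambda ((hnorm h)^-1%:C *: h)) =
    hnorm ((hnorm h)^-1%:C *: relax S lambda h).
  by rewrite /hnorm (heq_hdotl _ eqZ) (heq_hdotr _ eqZ).
rewrite hnormZ cmodR gtr0_norm ?invr_gt0 // -[opnorm T]fineK // lee_fin.
by rewrite ler_pdivrMl // mulrC.
Qed.

End frames_bridge.

(** * Time-frequency shifts *)

Section gabor_operator.
Context {R : realType}.
Local Notation H := (L2space R).
Local Notation mu := (@lebesgue_measure R).

Definition cis (t : R) : R[i] := cos t +i* sin t.

Lemma cisD s t : cis (s + t) = cis s * cis t.
Proof.
by rewrite /cis cosD sinD; apply/eqP; rewrite eq_complex /= eqxx addrC eqxx.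
Qed.

Lemma cmod_cis t : cmod (cis t) = 1.
Proof. by rewrite /cmod /= cos2Dsin2 sqrtr1. Qed.

Context (a b : R).
Implicit Types (k l : int * int) (f g : R -> R[i]).

Lemma gaborE f k t : gabor f a b k t =
  cis (2 * pi * (k.1%:~R * b) * t) * f (t - k.2%:~R * a).
Proof. by []. Qed.

Lemma sqmod_gabor f k t : sqmod (gabor f a b k) t = sqmod f (t - k.2%:~R * a).
Proof. by rewrite /sqmod -!sqr_cmod gaborE cmodM cmod_cis mul1r. Qed.

Lemma dotf_gabor f g k t :
  dotf (gabor f a b k) (gabor g a b k) t = dotf f g (t - k.2%:~R * a).
Proof.
rewrite /dotf !gaborE rmorphM /= mulrACA.
by rewrite mul_conjc cmod_cis expr1n mul1r.
Qed.

Lemma L2_gabor f k : L2 f -> L2 (gabor f a b k).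
Proof.
move=> /L2P[fr fi ff]; set s := k.2%:~R * a.
have mc : measurable_fun (setT : set (measurableTypeR R))
    (fun t : R => cos (2 * pi * (k.1%:~R * b) * t)).
  apply: (measurableT_comp (continuous_measurable_fun (@continuous_cos R))).
  exact: measurable_funM.
have ms : measurable_fun (setT : set (measurableTypeR R))
    (fun t : R => sin (2 * pi * (k.1%:~R * b) * t)).
  apply: (measurableT_comp (continuous_measurable_fun (@continuous_sin R))).
  exact: measurable_funM.
have gr := measurableT_comp fr (measurable_shift s).
have gi := measurableT_comp fi (measurable_shift s).
apply/L2P; split.
- under eq_fun do rewrite gaborE Re_mul.
  by apply: measurable_funB; apply: measurable_funM.
- under eq_fun do rewrite gaborE Im_mul.
  by apply: measurable_funD; apply: measurable_funM.
have := integrable_shift s ff; congr (is_true (integrable _ _ _)).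
by apply/funext => t /=; rewrite sqmod_gabor.
Qed.

Definition gabor_op k (x : H) : H := MkL2fun (L2_gabor k (L2valP x)).

Lemma gabor_opD k (x y : H) : gabor_op k (x + y) = gabor_op k x + gabor_op k y.
Proof. by apply/L2val_inj/funext => t; rewrite /= !gaborE mulrDr. Qed.

Lemma gabor_opZ k c (x : H) : gabor_op k (c *: x) = c *: gabor_op k x.
Proof. by apply/L2val_inj/funext => t; rewrite /= !gaborE mulrCA. Qed.

Lemma gabor_op_dot k (x y : H) : hdot (gabor_op k x) (gabor_op k y) = hdot x y.
Proof.
have [xr xi] := integrable_dotf (L2valP x) (L2valP y).
rewrite /= !L2dotE -(Rintegral_shift (k.2%:~R * a) xr).
rewrite -(Rintegral_shift (k.2%:~R * a) xi).
by congr (_ +i* _); apply: eq_Rintegral => t _; rewrite dotf_gabor.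
Qed.

(** The phase comes from moving the modulation of the inner shift past the
    translation of the outer one. *)
Lemma gabor_op_comp k l (x : H) : gabor_op k (gabor_op l x) =
  cis (- (2 * pi * (l.1%:~R * b) * (k.2%:~R * a))) *:
    gabor_op (k.1 + l.1, k.2 + l.2) x.
Proof.
apply/L2val_inj/funext => t; rewrite /= !gaborE /= !mulrA -!cisD.
congr (cis _ * L2val x _).
  by rewrite !intrD; ring.
by rewrite intrD; ring.
Qed.

(** A shift permutes the Gabor system up to phases. *)
Lemma gabor_op_frame_operator (x : H) (S : H -> H) k h :
  is_frame_operator (fun l => gabor_op l x) S ->
  heq (gabor_op k (S h)) (S (gabor_op k h)).
Proof.
move=> uS.
pose add (l : int * int) : int * int := (k.1 + l.1, k.2 + l.2).
pose sub (l : int * int) : int * int := (l.1 - k.1, l.2 - k.2).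
apply: (frame_operator_commute uS (U := gabor_op k) (f := add) (g := sub)
  (c := fun l => cis (- (2 * pi * (l.1%:~R * b) * (k.2%:~R * a))))).
- exact: gabor_opD.
- exact: gabor_opZ.
- exact: gabor_op_dot.
- by case=> m n; rewrite /add /sub /=; congr (_, _); ring.
- by case=> m n; rewrite /add /sub /=; congr (_, _); ring.
- by move=> l; exact: gabor_op_comp.
- by move=> l; exact: cmod_cis.
Qed.

Lemma gabor_op_relax_step (x : H) (S : H -> H) lambda k y :
  is_frame_operator (fun l => gabor_op l x) S ->
  heq (gabor_op k (relax_step S lambda x y))
      (lambda%:C *: gabor_op k x + relax S lambda (gabor_op k y)).
Proof.
move=> uS; rewrite /relax_step /relax -scaleN1r scalerA.
rewrite !gabor_opD !gabor_opZ -scalerA scaleN1r.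
apply: heqD (heq_refl _) (heqB (heq_refl _) (heqZ _ _)).
exact: gabor_op_frame_operator.
Qed.

End gabor_operator.

(** * Compact supports *)

Section supports.
Context {R : realType}.
Local Notation H := (L2space R).
Local Notation mu := (@lebesgue_measure R).
Implicit Types (x y : H) (M : R).

Definition cutf M (f : R -> R[i]) t := if `|t| <= M then f t else 0.

Lemma L2_cutf M f : L2 f -> L2 (cutf M f).
Proof.
move=> Lf; have /L2P[fr fi ff] := Lf.
have mM : @measurable _ (measurableTypeR R) [set t | `|t| <= M].
  rewrite (_ : [set t | _] = `[- M, M]%classic).
    exact: measurable_itv.
  by apply/seteqP; split=> t /=; rewrite in_itv /= ler_norml.
have part (F : R[i] -> R) : F 0 = 0 ->
    measurable_fun (setT : set (measurableTypeR R)) (fun t => F (f t)) ->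
    measurable_fun (setT : set (measurableTypeR R)) (fun t => F (cutf M f t)).
  move=> F0 mF; rewrite (_ : (fun t => _) =
      fun t => \1_[set t | `|t| <= M] t * F (f t)).
    by apply: measurable_funM => //; exact: measurable_indic.
  apply/funext => t; rewrite /cutf indicE; case: ifPn => tM.
    by rewrite mem_set // mul1r.
  by rewrite memNset ?mul0r //; exact/negP.
apply: (L2_le (part (@Re R) _ fr) (part (@Im R) _ fi) Lf Lf) => // t.
have := sqmod_ge0 f t; rewrite /sqmod /cutf; case: ifP => _ /=; first by lra.
by rewrite expr0n /=; lra.
Qed.

Definition cut M x : H := MkL2fun (L2_cutf M (L2valP x)).

Lemma cutD M x y : cut M (x + y) = cut M x + cut M y.
Proof.
by apply/L2val_inj/funext => t; rewrite /= /cutf; case: ifP; rewrite ?addr0.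
Qed.

Lemma cutZ M c x : cut M (c *: x) = c *: cut M x.
Proof.
by apply/L2val_inj/funext => t; rewrite /= /cutf; case: ifP; rewrite ?mulr0.
Qed.

Lemma hnorm_cut M x : hnorm (cut M x) <= hnorm x.
Proof.
rewrite ler_wsqrtr // !Re_L2dot le_Rintegral //.
- by have /L2P[] := L2valP (cut M x).
- by have /L2P[] := L2valP x.
move=> t _; rewrite /sqmod /= /cutf; case: ifP => // _.
by rewrite /= expr0n addr0 sqmod_ge0.
Qed.

Lemma cut_lipschitz M x y : hnorm (cut M x - cut M y) <= 1 * hnorm (x - y).
Proof.
by rewrite mul1r -(scaleN1r (cut M y)) -cutZ -cutD scaleN1r hnorm_cut.
Qed.

Definition supported M x := heq x (cut M x).

Lemma supported_heq M x y : heq x y -> supported M x -> supported M y.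
Proof.
move=> xy sx; apply: heq_trans (heq_sym xy) (heq_trans sx _).
by apply: hnorm_le0; apply: le_trans (cut_lipschitz _ _ _) _; rewrite xy mulr0.
Qed.

Lemma supported_pointwise M x : (forall t, M < `|t| -> L2val x t = 0) -> supported M x.
Proof.
move=> xM; rewrite /supported (_ : cut M x = x); first exact: heq_refl.
apply/L2val_inj/funext => t; rewrite /= /cutf; case: ifP => //.
by move/negbT; rewrite -ltNge => /xM ->.
Qed.

Lemma cut_supported M M' x : M <= M' -> supported M' (cut M x).
Proof.
move=> MM'; apply: supported_pointwise => t /(le_lt_trans MM').
by rewrite ltNge /= /cutf => /negbTE ->.
Qed.

Lemma supported_mono M M' x : M <= M' -> supported M x -> supported M' x.
Proof. by move=> /(@cut_supported M _ x) h /heq_sym sx; exact: supported_heq h. Qed.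

Lemma supportedD M x y : supported M x -> supported M y -> supported M (x + y).
Proof. by move=> sx sy; rewrite /supported cutD; exact: heqD. Qed.

Lemma supportedZ M c x : supported M x -> supported M (c *: x).
Proof. by move=> sx; rewrite /supported cutZ; exact: heqZ. Qed.

(** Truncation to [-M, M] is continuous, so it can be applied term by term. *)
Lemma supported_hsum (I : choiceType) M (u : I -> H) s :
  (forall k, supported M (u k)) -> hsum u s -> supported M s.
Proof.
move=> uM us; have : hsum (fun k => cut M (u k)) (cut M s).
  apply: (hsum_map _ (cut_lipschitz M) us) => x y.
  by rewrite cutD; exact: heq_refl.
move=> /(hsum_heq (fun k => heq_sym (uM k)) (heq_refl _)).
exact: hsum_unique us.
Qed.

Lemma supported_compactly x :
  compactly_supported (L2val x) <-> exists M, supported M x.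
Proof.
split=> [[K cK Kx]|[M /heq_ae xM]].
  have [M [_ hM]] := compact_bounded cK.
  exists (M + 1); apply/heq_ae; move: Kx; apply: ae_imply => t Kt.
  rewrite /= /cutf; case: ifP => // /negbT; rewrite -ltNge => tM; apply: Kt => Kt.
  have := hM (M + 1) ltac:(by rewrite ltrDl) t Kt.
  by rewrite /= leNgt tM.
exists `[- M, M]%classic; first exact: segment_compact.
move: xM; apply: ae_imply => t -> Kt; rewrite /= /cutf.
by case: ifP => // tM; exfalso; apply: Kt; rewrite /= in_itv /= -ler_norml.
Qed.

(** When x and y vanish outside of [-M, M], a translate of y by more than 2 M is
    orthogonal to x, and any other translate vanishes outside of [-3 M, 3 M]. *)
Lemma gabor_term_supported a b M x y k : 0 <= M -> supported M x -> supported M y ->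
  supported (3 * M) (hdot x (gabor_op a b k y) *: gabor_op a b k y).
Proof.
move=> M0 sx sy; set s := k.2%:~R * a.
have yc : heq (gabor_op a b k y) (gabor_op a b k (cut M y)).
  have := gabor_op_dot a b k (y - cut M y) (y - cut M y).
  rewrite -{1 2}scaleN1r !gabor_opD !gabor_opZ !scaleN1r => e.
  by rewrite /heq /hnorm e; exact: sy.
have [sM|sM] := leP `|s| (2 * M).
  apply: supportedZ; apply: supported_heq (heq_sym yc) _.
  apply: supported_pointwise => t tM; rewrite /= gaborE /= /cutf -/s.
  case: ifP => // h; last by rewrite mulr0.
  by exfalso; have := ler_normD (t - s) s; rewrite subrK; lra.
rewrite (heq_hdotl _ sx) (heq_hdotr _ yc).
have -> : hdot (cut M x) (gabor_op a b k (cut M y)) = 0.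
  rewrite /= L2dotE.
  have z t : dotf (cutf M (L2val x)) (gabor (cutf M (L2val y)) a b k) t = 0.
    rewrite /dotf gaborE -/s /cutf; case: ifP => h; last by rewrite mul0r.
    case: ifP => h'; last by rewrite mulr0 conjc0 mulr0.
    by exfalso; have := ler_normB t (t - s); rewrite subKr; lra.
  apply/eqP; rewrite eq_complex /=; apply/andP; split; apply/eqP.
    by under eq_Rintegral do rewrite z /=; rewrite Rintegral_cst // mul0r.
  by under eq_Rintegral do rewrite z /=; rewrite Rintegral_cst // mul0r.
rewrite scale0r; apply: supported_pointwise => t _; by [].
Qed.

Lemma supported_relax_step a b lambda M x y (S : H -> H) :
  is_frame_operator (fun k => gabor_op a b k x) S -> 0 <= M ->
  supported M x -> supported M y -> supported (3 * M) (relax_step S lambda x y).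
Proof.
move=> uS M0 sx sy; have M3M : M <= 3 * M by lra.
have sS : supported (3 * M) (S y).
  by apply: supported_hsum (uS y) => k; exact: gabor_term_supported.
rewrite /relax_step /relax -scaleN1r.
by apply: supportedD (supportedZ _ _) (supportedD _ (supportedZ _ (supportedZ _ sS)));
  exact: supported_mono M3M _.
Qed.

End supports.

Theorem proposition1p2 (R : realType) (g gd : R -> R[i]) (a b lambda : R)
  (g_L2 : L2 g) (gd_L2 : L2 gd) (a_gt0 : 0 < a) (b_gt0 : 0 < b)
  (G_frame : is_frame (gabor g a b))
  (Gd_dual : is_dual_frame (gabor g a b) (gabor gd a b))
  (lambda_gt0 : 0 < lambda)
  (contraction :
    (opnorm (id_sub_scaled lambda (frame_op (gabor g a b))) < 1)%E) :
  [/\ forall p : nat, dual_window g a b (window_seq g gd a b lambda p),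
      L2cvg (window_seq g gd a b lambda) (canonical_dual_window g a b) &
      compactly_supported g -> compactly_supported gd ->
      forall p : nat, (0 < p)%N ->
        compactly_supported (window_seq g gd a b lambda p)].
Proof.
pose x : L2space R := MkL2fun g_L2; pose xd : L2space R := MkL2fun gd_L2.
pose u k := gabor_op a b k x.
have [B B0 uB] : exists2 B, 0 < B & bessel u B by exact: frame_bessel.
have [S uS SE] := frame_op_frame_operator B0 uB.
have [c c01 contr] := opnorm_relax uS SE contraction.
have /andP[c0 c1] := c01.
pose step := relax_step S lambda x; pose w p := iter p step xd.
have stepL : forall y z, hnorm (step y - step z) <= c * hnorm (y - z).
  exact: relax_step_lipschitz.
have windowE p : window_seq g gd a b lambda p = L2val (w p).
  elim: p => //= p ->; apply/funext => t.
  by rewrite /id_sub_scaled /= -SE mulN1r.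
have dual p : bessel_dual u (fun k => gabor_op a b k (w p)).
  elim: p => [|p [[B' B'0 vB'] uv vu]]; first exact: dual_frame_bessel_dual.
  have vE k : heq (gabor_op a b k (w p.+1))
      (lambda%:C *: u k + relax S lambda (gabor_op a b k (w p))).
    exact: (gabor_op_relax_step lambda k (w p) uS).
  split.
  - exists (2 * (lambda ^+ 2 * B + B' * c ^+ 2)).
      have := mulr_gt0 (exprn_gt0 2 lambda_gt0) B0.
      by have := mulr_ge0 (ltW B'0) (exprn_ge0 2 c0); lra.
    by apply: (dual_step_bessel uS contr vE uB vB'); exact: ltW.
  - exact: (dual_step_reconstructs uS contr vE).
  - exact: (dual_step_reconstructs_swap uS vE).
split.
- move=> p; rewrite windowE; split; first exact: L2valP.
  exact: (bessel_dual_frame B0 uB (dual p)).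
- have [z zfix] := contraction_fixpoint c01 stepL.
  have fixP y := relax_step_fixpoint S x y lambda_gt0.
  have aeP y : frame_op (gabor g a b) (L2val y) = g %[ae lebesgue_measure] <->
      heq (S y) x.
    rewrite -[gabor g a b]/(fun k => L2val (u k)) -SE.
    split=> [h|/heq_ae]; last by apply: ae_imply => t h _.
    by apply/heq_ae; move: h; apply: ae_imply => t; apply.
  (* The fixpoint z shows that the set from which S^-1 g is chosen is inhabited;
     the chosen element y is again a fixpoint. *)
  have [Ly Sy] : L2 (canonical_dual_window g a b) /\
      frame_op (gabor g a b) (canonical_dual_window g a b) = g %[ae lebesgue_measure].
    apply: (@xgetPex _ (cst 0 : {classic R -> R[i]})
      [set s | L2 s /\ frame_op (gabor g a b) s = g %[ae lebesgue_measure]]).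
    exists (L2val z); split; first exact: L2valP.
    exact: (proj2 (aeP z) (proj1 (fixP z) zfix)).
  pose y : L2space R := MkL2fun Ly.
  have yfix : heq (step y) y := proj2 (fixP y) (proj1 (aeP y) Sy).
  have normE p : L2norm (fun t => window_seq g gd a b lambda p t -
      canonical_dual_window g a b t) = (hnorm (w p - y))%:E.
    rewrite -L2norm_hnorm; congr L2norm; apply/funext => t.
    by rewrite windowE [RHS]L2valB.
  rewrite /L2cvg; under eq_fun do rewrite normE.
  apply: cvg_EFin; first exact: nearW.
  apply/cvgrPdist_lt => e e0.
  have [N hN] := geometric_small (hnorm (xd - y)) c01 e0.
  exists N => // p /= /hN; apply: le_lt_trans.
  rewrite sub0r normrN ger0_norm ?hnorm_ge0 //.
  exact: contraction_iter_fixpoint.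
move=> /(supported_compactly x) [M1 s1] /(supported_compactly xd) [M2 s2] p _.
rewrite windowE; apply/supported_compactly.
elim: p => [|p [M3 s3]]; first by exists M2.
pose M := Num.max 0 (Num.max M1 M3).
have M0 : 0 <= M by rewrite le_max lexx.
exists (3 * M); apply: (supported_relax_step lambda uS M0).
  by apply: supported_mono s1; rewrite !le_max lexx orbT.
by apply: supported_mono s3; rewrite !le_max lexx !orbT.
Qed.
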